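(* Let $\Sigma$ be a positive continuous-time semi-Markovian jump linear system such that, for some constants $T>0$ and $R>0$, one has $0<h_k\le T$ and $\|J_k\|\le R$ for every $k\ge 0$. Let $m$ be a positive integer. Then $\Sigma$ is exponentially $m$-th mean stable if and only if the block matrix $\mathcal A_m(\Sigma)\in\mathbb R^{(n_mN)\times(n_mN)}$ whose $(i,j)$-block ($1\le i,j\le N$) is $$[\mathcal A_m(\Sigma)]_{ij}=p_{ji}\,E\big[(J_ke^{A_{\sigma_k}h_k})^{[m]}\,\big|\,\sigma_k=j,\ \sigma_{k+1}=i\big]\in\mathbb R^{n_m\times n_m}$$ is Schur stable, i.e. has spectral radius $\rho(\mathcal A_m(\Sigma))<1$.
   Context: Setting. Let $A_1,\dots,A_N$ be real $n\times n$ matrices. On a probability space $(\Omega,\mathcal M,P)$ let $\{\sigma_k\}_{k\ge0}$, $\{t_k\}_{k\ge0}$, $\{J_k\}_{k\ge0}$ be stochastic processes with values in $\{1,\dots,N\}$, $\mathbb R_+$, $\mathbb R^{n\times n}$, with $\{t_k\}$ non-decreasing, $t_0=0$, $\sigma_0$ constant, and put $h_k=t_{k+1}-t_k$. The switched system $\Sigma$ is: $\frac{dx}{dt}=A_{\sigma_k}x(t)$ for $t_k\le t<t_{k+1}$, and $x(t_{k+1})=J_kx(t_{k+1}^-)$ for $k\ge0$ ($x(t^-)$ is the left limit), with constant initial state $x(0)=x_0\in\mathbb R^n$. $\Sigma$ is a continuous-time semi-Markovian jump linear system if for all $i,j\in\{1,\dots,N\}$, $t\ge0$, $k\ge 0$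 and Borel $B\subset\mathbb R^{n\times n}$: (1) $P(\sigma_{k+1}=j,h_k\le t,J_k\in B\mid\sigma_k,\dots,\sigma_0,t_k,\dots,t_0,J_{k-1},\dots,J_0)=P(\sigma_{k+1}=j,h_k\le t,J_k\in B\mid\sigma_k)$; (2) $P(\sigma_{k+1}=j,h_k\le t,J_k\in B\mid\sigma_k=i)$ is independent of $k$. It is positive if moreover each $A_i$ is Metzler (off-diagonal entries nonnegative) and each $J_k$ is entrywise nonnegative with probability 1. Then $\{\sigma_k\}$ is a time-homogeneous Markov chain; $[p_{ij}]$ denotes its transition matrix, $p_{ij}=P(\sigma_{k+1}=j\mid\sigma_k=i)$. When the initial mode $\sigma_0$ varies over $\{1,\dots,N\}$, the transition law in (2) (given for every $i$) is kept fixed. The conditional expectation in $\mathcal A_m(\Sigma)$ does not depend on $k$, and a block with $p_{ji}=0$ is $0$. Stability. $\Sigma$ is exponentially $m$-th mean stable if there exist $C>0$, $\beta>0$ such that $E[\|x(t)\|^m]\le Ce^{-\beta t}\|x_0\|^m$ for all $t\ge0$, all $x_0\in\mathbb R^n$ and all $\sigma_0\in\{1,\dots,N\}$ (the choice of norm on $\mathbb R^n$ is immaterial). Notation. $n_m=\binom{n+m-1}{m}$. For $x\in\mathbb R^n$, $x^{[m]}\in\mathbb R^{n_m}$ is the vector of all lexicographically ordered degree-$m$ monomials in $x_1,\dots,x_n$, with positive coefficients chosen so that $\|x\|_2^m=\|x^{[m]}\|_2$ (the coefficient of $x_1^{a_1}\cdots x_n^{a_n}$ is $\sqrt{m!/(a_1!\cdots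 a_n!)}$). For $A\in\mathbb R^{n\times n}$, $A^{[m]}\in\mathbb R^{n_m\times n_m}$ is the unique matrix with $(Ax)^{[m]}=A^{[m]}x^{[m]}$ for all $x\in\mathbb R^n$. *)

(* Defs.v *)
From HB Require Import structures.
From mathcomp Require Import all_boot all_order all_algebra.
From mathcomp Require Import all_classical all_reals all_analysis.
From mathcomp Require Import complex.
Set Implicit Arguments.
Unset Strict Implicit.
Unset Printing Implicit Defensive.
Import Order.TTheory GRing.Theory Num.Theory.
Import numFieldNormedType.Exports.
Local Open Scope classical_set_scope.
Local Open Scope ring_scope.

(** ** Linear algebra *)

(* Exponents of the degree-[m] monomials in [n] variables, in lexicographic
   order: x_1^m comes first, x_n^m last. *)
Fixpoint monomials (n m : nat) : seq (seq nat) :=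
  if n is n'.+1 then
    flatten [seq [seq a :: e | e <- monomials n' (m - a)] | a <- rev (iota 0 m.+1)]
  else if m is 0%N then [:: [::]] else [::].

Definition lift_dim (n m : nat) : nat := 'C((n + m).-1, m).

Lemma size_monomials (n m : nat) : size (monomials n m) = lift_dim n m.
Proof.
rewrite /lift_dim; elim: n m => [|n IHn] m.
  by case: m => [|m]; rewrite ?bin0 //= bin_small.
rewrite [monomials _ _]/= -/(iota 0 m.+1) size_flatten /shape -map_comp.
have -> : map (size \o (fun a => [seq a :: e | e <- monomials n (m - a)]))
            (rev (iota 0 m.+1)) =
          [seq 'C((n + b).-1, b) | b <- iota 0 m.+1].
  apply: (@eq_from_nth _ 0%N); first by rewrite !size_map size_rev.
  move=> i; rewrite size_map size_rev size_iota => lti.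
  rewrite !(nth_map 0%N) ?size_rev ?size_iota // /comp size_map nth_rev;
    last by rewrite size_iota.
  by rewrite size_iota !nth_iota ?subSS ?ltnS ?leq_subr // !add0n subKn // IHn.
elim: m => [|m IHm]; first by rewrite /= !bin0.
rewrite -[m.+2]addn1 iotaD map_cat sumn_cat IHm /= addn0 !addnS /=.
by rewrite binS addnC.
Qed.

Section Matrices.
Variable R : realType.

Definition lift_vec (n m : nat) (x : 'cV[R]_n) : 'cV[R]_(lift_dim n m) :=
  \col_i let a := nth [::] (monomials n m) i in
    Num.sqrt (m`!%:R / (\prod_(e <- a) e`!)%:R) *
    \prod_(l < n) x l 0 ^+ nth 0%N a l.

(* The unique [M] such that [(A x)^[m] = M x^[m]] for all [x]. *)
Definition lift_mx (n m : nat) (A : 'M[R]_n) : 'M[R]_(lift_dim n m) :=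
  xget 0 [set M | forall x : 'cV[R]_n, lift_vec m (A *m x) = M *m lift_vec m x].

Definition expmx (n : nat) (A : 'M[R]_n) : 'M[R]_n :=
  limn (series (fun k : nat => k`!%:R^-1 *: A ^+ k)).

Definition metzler (n : nat) (A : 'M[R]_n) : Prop :=
  forall i j, i != j -> 0 <= A i j.

Definition nonneg_mx (n : nat) (A : 'M[R]_n) : Prop := forall i j, 0 <= A i j.

Definition spectral_radius (n : nat) (A : 'M[R]_n) : R :=
  sup [set ComplexField.Normc.normc z | z in
        [set z : R[i] | eigenvalue (map_mx (real_complex R) A) z]].

Definition borel_mx (p q : nat) : set (set 'M[R]_(p, q)) :=
  <<s [set U | open U] >>.

End Matrices.

(** ** Conditioning *)

Section Conditioning.
Context d (T : measurableType d) (R : realType) (P : probability T R).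

(* [f] is a version of the conditional probability of [E] given [G]. *)
Definition is_cond_prob (G : set (set T)) (E : set T) (f : T -> R) : Prop :=
  [/\ forall Y, measurable Y -> G (f @^-1` Y),
      P.-integrable setT (EFin \o f)
    & forall B, G B -> (\int[P]_(w in B) (f w)%:E = P (B `&` E))%E].

Definition cond_prob (E F : set T) : R := fine (P (E `&` F)) / fine (P F).

Definition cond_mean (f : T -> R) (F : set T) : R :=
  fine (\int[P]_(w in F) (f w)%:E)%E / fine (P F).

End Conditioning.

(** ** Switching processes *)

Record switching (R : realType) (N n : nat) := Switching {
  disp : measure_display;
  Omega : measurableType disp;
  Prob : probability Omega R;
  mode : nat -> Omega -> 'I_N;
  time : nat -> Omega -> R;
  reset : nat -> Omega -> 'M[R]_n;
  measurable_mode : forall k j, measurable (mode k @^-1` [set j]);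
  measurable_time : forall k, measurable_fun setT (time k);
  measurable_reset : forall k B, borel_mx B -> measurable (reset k @^-1` B);
  time0 : forall w, time 0%N w = 0;
  time_nondecreasing : forall k w, time k w <= time k.+1 w
}.

Section Process.
Context (R : realType) (N n : nat) (X : switching R N n).

Definition holding (k : nat) (w : Omega X) : R := time k.+1 w - time k w.

Definition mode_is (k : nat) (i : 'I_N) : set (Omega X) :=
  mode k @^-1` [set i].

Definition transition (k : nat) (j : 'I_N) (u : R) (B : set 'M[R]_n) :
    set (Omega X) :=
  [set w | [/\ mode k.+1 w = j, holding k w <= u & B (reset k w)]].

Definition sigma_mode (k : nat) : set (set (Omega X)) :=
  <<s [set D | exists i, D = mode_is k i] >>.

(* Generated by sigma_0, ..., sigma_k, t_0, ..., t_k, J_0, ..., J_(k-1). *)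
Definition sigma_history (k : nat) : set (set (Omega X)) :=
  <<s [set D | [\/ exists l i, (l <= k)%N /\ D = mode_is l i,
                   exists l Y, [/\ (l <= k)%N, measurable Y & D = time l @^-1` Y]
                 | exists l B, [/\ (l < k)%N, borel_mx B & D = reset l @^-1` B]]] >>.

(* P(sigma_(k+1) = i | sigma_k = j) *)
Definition trans_prob (k : nat) (j i : 'I_N) : R :=
  cond_prob (Prob X) (mode_is k.+1 i) (mode_is k j).

End Process.

Arguments sigma_mode {R N n} X k _.
Arguments sigma_history {R N n} X k _.

(* A family indexed by the initial mode. The last clause says at once that the
   transition law is independent of [k] and that it is the same for all initial
   modes; the law out of [i] is always given, by [X i] at [k = 0]. *)
Definition semi_markovian (R : realType) (N n : nat)
    (X : 'I_N -> switching R N n) : Prop :=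
  [/\ forall s (w : Omega (X s)), mode 0 w = s,
      forall s k j (u : R) (B : set 'M[R]_n), 0 <= u -> borel_mx B ->
        exists f, is_cond_prob (Prob (X s)) (sigma_history (X s) k)
                    (transition k j u B) f /\
                  is_cond_prob (Prob (X s)) (sigma_mode (X s) k)
                    (transition k j u B) f
    & forall s s' k k' i j (u : R) (B : set 'M[R]_n), 0 <= u -> borel_mx B ->
        Prob (X s) (mode_is k i) != 0%E ->
        Prob (X s') (mode_is k' i) != 0%E ->
        cond_prob (Prob (X s)) (transition k j u B) (mode_is k i) =
        cond_prob (Prob (X s')) (transition k' j u B) (mode_is k' i)].

Section System.
Context (R : realType) (N n : nat) (A : 'I_N -> 'M[R]_n).

Definition positive_system (X : 'I_N -> switching R N n) : Prop :=
  (forall i, metzler (A i)) /\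
  (forall s k, {ae Prob (X s), forall w, nonneg_mx (reset k w)}).

(* The difference quotient is taken within [t_k, t_(k+1)[, so at [t_k] it is the
   right derivative. *)
Definition trajectory (sigma : nat -> 'I_N) (t : nat -> R) (J : nat -> 'M[R]_n)
    (x0 : 'cV[R]_n) (x : R -> 'cV[R]_n) : Prop :=
  [/\ x 0 = x0,
      forall k u, t k <= u < t k.+1 ->
        (v - u)^-1 *: (x v - x u) @[v --> within `[t k, t k.+1[ u^'] -->
          A (sigma k) *m x u
    & forall k, exists2 y, x v @[v --> (t k.+1)^'-] --> y &
        x (t k.+1) = J k *m y].

(* Almost surely: the switching times may coincide on a null set. Nothing is
   required from [sup_k t_k] on, if finite. *)
Definition solution (X : switching R N n) (x0 : 'cV[R]_n)
    (x : R -> Omega X -> 'cV[R]_n) : Prop :=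
  (forall u B, borel_mx B -> measurable (x u @^-1` B)) /\
  {ae Prob X, forall w, trajectory (fun k => mode k w) (fun k => time k w)
                          (fun k => reset k w) x0 (fun u => x u w)}.

Definition exp_mean_stable (m : nat) (X : 'I_N -> switching R N n) : Prop :=
  exists C beta : R, [/\ 0 < C, 0 < beta &
    forall (s : 'I_N) (x0 : 'cV[R]_n) (x : R -> Omega (X s) -> 'cV[R]_n),
      solution x0 x -> forall u, 0 <= u ->
        ('E_(Prob (X s))[fun w => (`|x u w| ^+ m)%R] <=
           (C * expR (- beta * u) * `|x0| ^+ m)%:E)%E].

(* E[(J_k e^(A_(sigma_k) h_k))^[m] | sigma_k = j, sigma_(k+1) = i] *)
Definition mean_lift (m : nat) (X : switching R N n) (k : nat) (j i : 'I_N) :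
    'M[R]_(lift_dim n m) :=
  \matrix_(a, b)
    cond_mean (Prob X)
      (fun w => lift_mx m (reset k w *m expmx (holding k w *: A (mode k w))) a b)
      (mode_is k j `&` mode_is k.+1 i).

(* The entries do not depend on [k] nor on the initial mode; [k = 0] and initial
   mode [j] make the conditioning on [sigma_k = j] meaningful for every [j].
   A block with [p_ji = 0] is [0 *: _]. *)
Definition transition_mx (m : nat) (X : 'I_N -> switching R N n) :
    'M[R]_(\sum_(i < N) lift_dim n m) :=
  \mxblock_(i < N, j < N)
    (trans_prob (X j) 0 j i *: mean_lift m (X j) 0 j i).

End System.

(* Main.v *)
Require Import Defs.
From HB Require Import structures.
From mathcomp Require Import all_boot all_order all_algebra.
From mathcomp Require Import all_classical all_reals all_analysis.
From mathcomp Require Import measurable_realfun.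
From mathcomp Require Import complex ring lra.
Set Implicit Arguments.
Unset Strict Implicit.
Unset Printing Implicit Defensive.
Import Order.TTheory GRing.Theory Num.Theory.
Import numFieldNormedType.Exports.
Local Open Scope classical_set_scope.
Local Open Scope ring_scope.

(** Between two switches the state is multiplied by an exponential, so after [k]
    switches it is [M_k x_0], where [M_k] is the product of the random nonnegative
    matrices [J_l e^(h_l A_(sigma_l))] for [l < k]; this product is [cocycle]. The
    lift is multiplicative ([lift_mxM]). By the semi-Markov property, given
    [sigma_k = j] the step [(h_k, J_k, sigma_(k+1))] is independent of the past and
    has the law of the first step from [j] ([semi_markov_integral]). By induction on
    [k], the expectation of the lift of [M_k] on the event [sigma_k = i], started
    from mode [s], is the [(i, s)] block of the [k]-th power of the transition matrix
    ([moment_power]). Positivity excludes cancellations: with [1] the vector of ones,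
    the sum of the entries of the lift of [M_k] and [`|M_k 1| ^ m] bound each other up
    to constants ([norm_cocycle_le], [lift_cocycle_le]). What remains is to compare
    the switching times with the deterministic times of the definition of stability.

    If the spectral radius is less than one, the powers of the transition matrix
    decay like [r ^ k] with [r < 1] ([spectral_radius_lt1_decay], by the
    Cayley-Hamilton theorem). As [t_k <= k T], the number of switches up to time [u]
    is at least [u / T - 1], so that [`|x(u)| ^ m] is at most a constant times the sum
    of the lifts of all later [M_k]. The expectation of this sum is a geometric tail.
    That [u] belongs to some interval between switches is almost sure, since
    [E e^(-t_k)] decays geometrically and so the switching times tend to infinity
    ([ae_time_unbounded]).

    Conversely, choose [delta] such that from every mode the holding time is at
    least [delta] with probability at least 1/2 ([holding_lower_bound]). An interval
    between switches of length at least [delta] contains a multiple [j delta],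
    different intervals contain different multiples ([sampling_sum_le]), and at the
    time [j delta] the state is [M_k x_0] up to a bounded factor with bounded inverse.
    Hence the sum over [k] of the expectations of [`|M_k 1| ^ m] on the events
    [delta <= h_k] is bounded by the sum over [j] of those of [`|x(j delta)| ^ m],
    which is finite by stability. By independence, the restriction to [delta <= h_k]
    costs only a factor 2. So the powers of the transition matrix are summable, and
    the spectral radius is less than one ([spectral_radius_lt1_of_cvg]). *)

(** * Powers of a matrix and its spectral radius *)

Section SpectralRadius.
Variable R : realType.
Notation normc := (@ComplexField.Normc.normc R).

Local Lemma normc_ge0 (z : R[i]) : 0 <= normc z.
Proof. by case: z => a b; exact: sqrtr_ge0. Qed.
#[local] Hint Resolve normc_ge0 : core.

Local Lemma normc_real (x : R) : normc (x%:C)%C = `|x|.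
Proof. by rewrite /= expr0n addr0 sqrtr_sqr. Qed.

Local Lemma normcX (z : R[i]) k : normc (z ^+ k) = normc z ^+ k.
Proof.
elim: k => [|k IHk]; last by rewrite !exprS ComplexField.Normc.normcM IHk.
by rewrite !expr0 ComplexField.Normc.normc1.
Qed.

(** The operator [S - z], where [S] is the shift of sequences. *)
Let shift_sub (z : R[i]) (u : nat -> R[i]) k := u k.+1 - z * u k.

Local Lemma shift_sub_decay (z : R[i]) (u : nat -> R[i]) (r C : R) :
  normc z < r -> 0 <= C -> (forall k, normc (shift_sub z u k) <= C * r ^+ k) ->
  exists2 C', 0 <= C' & forall k, normc (u k) <= C' * r ^+ k.
Proof.
move=> zr C0 uC; have r0 : 0 < r by exact: le_lt_trans (normc_ge0 z) zr.
have rz : 0 < r - normc z by rewrite subr_gt0.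
pose C' := normc (u 0%N) + C / (r - normc z).
exists C'; first by rewrite addr_ge0 // divr_ge0 // ltW.
elim=> [|k IHk].
  by rewrite expr0 mulr1 lerDl divr_ge0 // ltW.
have -> : u k.+1 = shift_sub z u k + z * u k by rewrite /shift_sub subrK.
apply: (le_trans (le_normcD _ _)).
rewrite ComplexField.Normc.normcM.
apply: (@le_trans _ _ (C * r ^+ k + normc z * (C' * r ^+ k))).
  by rewrite lerD // ler_wpM2l.
rewrite mulrA -mulrDl exprS mulrA ler_wpM2r // ?exprn_ge0 // ?(ltW r0) //.
rewrite -lerBrDr mulrC -mulrBl mulrC /C' mulrDl divfK ?gt_eqF // lerDr.
by rewrite mulr_ge0 // ltW.
Qed.

Local Lemma shift_subs_decay (s : seq R[i]) (r : R) :
  0 < r -> (forall z, z \in s -> normc z < r) ->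
  forall (u : nat -> R[i]) C, 0 <= C ->
  (forall k, normc (foldr shift_sub u s k) <= C * r ^+ k) ->
  exists2 C', 0 <= C' & forall k, normc (u k) <= C' * r ^+ k.
Proof.
move=> r0; elim: s => [|z s IHs] sr u C C0 /= uC; first by exists C.
have [|C1 C10 uC1] := shift_sub_decay _ C0 uC; first by apply: sr; rewrite mem_head.
by apply: (IHs _ u C1) => // w ws; apply: sr; rewrite in_cons ws orbT.
Qed.

Local Lemma shift_subs_powers n (M : 'M[R[i]]_n.+1) a b (s : seq R[i]) k :
  foldr shift_sub (fun k => (M ^+ k) a b) s k =
  (M ^+ k * horner_mx M (\prod_(z <- s) ('X - z%:P))) a b.
Proof.
elim: s k => [|z s IHs] k; first by rewrite big_nil rmorph1 mulr1.
rewrite /= {1}/shift_sub !IHs big_cons rmorphM /= rmorphB /= horner_mx_X horner_mx_C.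
rewrite mulrA mulrBr -exprSr mulrBl; set H := horner_mx _ _.
have -> : M ^+ k * z%:M = z *: M ^+ k.
  by rewrite -[z *: _]mulr1 -scalerAl scalerAr -scalemx1.
rewrite -scalerAl; move: (_ * H) (_ * H) => A B; by rewrite !mxE.
Qed.

Local Lemma map_mx_pow n (M : 'M[R]_n) k :
  map_mx (real_complex R) M ^+ k = map_mx (real_complex R) (M ^+ k).
Proof.
elim: k => [|k IHk]; first by rewrite !expr0 -[1 in RHS]/(1%:M) map_mx1.
by rewrite !exprS IHk -[_ * _]/(_ *m _) -map_mxM.
Qed.

Let char_roots n (M : 'M[R]_n) : {s : seq R[i] |
  char_poly (map_mx (real_complex R) M) = \prod_(z <- s) ('X - z%:P)}.
Proof.
have [s sE] := closed_field_poly_normal (char_poly (map_mx (real_complex R) M)).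
by exists s; rewrite {1}sE (monicP (char_poly_monic _)) scale1r.
Qed.

Local Lemma eigenvalue_char_roots n (M : 'M[R]_n) z :
  eigenvalue (map_mx (real_complex R) M) z = (z \in sval (char_roots M)).
Proof.
by rewrite eigenvalue_root_char; case: char_roots => s /= ->; rewrite root_prod_XsubC.
Qed.

Local Lemma bounded_moduli n (M : 'M[R]_n) (z : R[i]) :
  z \in sval (char_roots M) -> normc z <= spectral_radius M.
Proof.
move=> zs; apply: ub_le_sup; last by exists z => //=; rewrite eigenvalue_char_roots.
exists (\sum_(w <- sval (char_roots M)) normc w); move=> _ [w /= + <-].
rewrite eigenvalue_char_roots => ws.
by rewrite (big_rem w) //= lerDl sumr_ge0.
Qed.

(** By the Cayley-Hamilton theorem, each entry of [M ^+ k] is a sequence that is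
    annihilated by the product of the operators [S - z] over the eigenvalues [z]
    of [M]; each factor can be inverted without losing a decay rate larger than
    the modulus of [z]. *)
Lemma spectral_radius_lt1_decay n (M : 'M[R]_n) : spectral_radius M < 1 ->
  exists C r : R, [/\ 0 < C, 0 < r < 1 & forall k a b, `|(M ^+ k) a b| <= C * r ^+ k].
Proof.
case: n M => [M _|n M rho1]; first by exists 1, 2^-1; split=> [||? []] //; lra.
(* The maximum with [1/2] makes [r] positive whatever the sign of the supremum. *)
pose r := Num.max (2^-1) ((1 + spectral_radius M) / 2).
have r0 : 0 < r by rewrite lt_max; apply/orP; left; lra.
have r1 : r < 1 by rewrite gt_max; apply/andP; split; lra.
pose Mc := map_mx (real_complex R) M.
have entry a b : exists2 C, 0 <= C & forall k, `|(M ^+ k) a b| <= C * r ^+ k.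
  have [] := @shift_subs_decay (sval (char_roots M)) r r0 _
    (fun k => (Mc ^+ k) a b) 0 (lexx _).
  - move=> z /bounded_moduli zr; apply: (le_lt_trans zr).
    by rewrite lt_max; apply/orP; right; lra.
  - move=> k; rewrite shift_subs_powers -(svalP (char_roots M)) Cayley_Hamilton.
    by rewrite mulr0 mxE ComplexField.Normc.normc0 mul0r.
  move=> C C0 MC; exists C => // k; have := MC k.
  by rewrite map_mx_pow mxE normc_real.
pose C (ab : 'I_n.+1 * 'I_n.+1) : R := s2val (cid2 (entry ab.1 ab.2)).
have C0 ab : 0 <= C ab by rewrite /C; case: cid2.
exists (1 + \sum_ab C ab), r; split; [|by rewrite r0 r1|].
  by rewrite ltr_pwDl // sumr_ge0.
move=> k a b; apply: (@le_trans _ _ (C (a, b) * r ^+ k)).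
  by rewrite /C; case: cid2 => /= C' _ ->.
rewrite ler_wpM2r ?exprn_ge0 ?(ltW r0) //.
by rewrite (bigD1 (a, b)) //= addrCA lerDl addr_ge0 // sumr_ge0.
Qed.

(** If [v] is a left eigenvector for [z], then [v *m M ^+ k = z ^+ k *: v], so that
    [z ^+ k] tends to 0. *)
Lemma spectral_radius_lt1_of_cvg n (M : 'M[R]_n) :
  (forall a b, (M ^+ k) a b @[k --> \oo] --> (0 : R)) -> spectral_radius M < 1.
Proof.
move=> Mcvg; pose s := sval (char_roots M); pose Mc := map_mx (real_complex R) M.
have s1 z : z \in s -> normc z < 1.
  rewrite -eigenvalue_char_roots => /eigenvalueP [v vM v0].
  have vMk k : v *m Mc ^+ k = z ^+ k *: v.
    elim: k => [|k IHk]; first by rewrite expr0 scale1r -[1]/(1%:M) mulmx1.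
    by rewrite exprS -[_ * _]/(_ *m _) mulmxA vM -scalemxAl IHk scalerA -exprS.
  have /existsP [b vb0] : [exists b, v 0 b != 0].
    apply: contraNT v0 => /existsPn vb; apply/eqP/rowP => b.
    by have := vb b; rewrite negbK mxE => /eqP.
  have vb_gt0 : 0 < normc (v 0 b).
    rewrite lt_neqAle normc_ge0 andbT eq_sym.
    by apply: contraNneq vb0 => /ComplexField.Normc.eq0_normc ->.
  have normc_sum (f : 'I_n -> R[i]) : normc (\sum_a f a) <= \sum_a normc (f a).
    elim/big_ind2 : _ => [|x1 x2 y1 y2 x12 y12|//].
      by rewrite ComplexField.Normc.normc0.
    exact: le_trans (le_normcD _ _) (lerD x12 y12).
  have : (\sum_a normc (v 0 a) * `|(M ^+ k) a b|) @[k --> \oo] --> (0 : R).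
    rewrite [X in _ --> X](_ : 0 = \sum_a normc (v 0 a) * `|0 : R|); last first.
      by rewrite big1 // => a _; rewrite normr0 mulr0.
    apply: cvg_big => [|a _]; first exact: add_continuous.
    by apply: cvgMr; apply: cvg_norm.
  move=> /cvgrPdist_lt /(_ _ vb_gt0) [k _ /(_ k (leqnn k)) /=].
  rewrite sub0r normrN ger0_norm; last by rewrite sumr_ge0 // => a _; rewrite mulr_ge0.
  move=> small; rewrite ltNge; apply/negP => z1; move: small; rewrite ltNge => /negP; apply.
  have := congr1 (fun w : 'rV_n => normc (w 0 b)) (vMk k).
  rewrite !mxE ComplexField.Normc.normcM normcX => vMb.
  apply: (@le_trans _ _ (normc z ^+ k * normc (v 0 b))).
    by rewrite ler_peMl // exprn_ege1.
  rewrite -vMb; apply: (le_trans (normc_sum _)); apply: ler_sum => a _.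
  by rewrite ComplexField.Normc.normcM map_mx_pow mxE normc_real.
have sub_max : [set normc z | z in
    [set z : R[i] | eigenvalue (map_mx (real_complex R) M) z]] `<=`
    [set x | x <= \big[Num.max/0]_(z <- s) normc z].
  move=> _ [z /= + <-]; rewrite eigenvalue_char_roots => zs.
  exact: le_bigmax_seq.
have [E0|/set0P E0] := eqVneq [set normc z | z in
    [set z : R[i] | eigenvalue (map_mx (real_complex R) M) z]] set0.
  by rewrite /spectral_radius E0 sup0.
apply: (@le_lt_trans _ _ (\big[Num.max/0]_(z <- s) normc z)).
  exact: ge_sup.
by rewrite big_seq; elim/big_rec: _ => // z x /s1 z1 x1; rewrite gt_max z1.
Qed.

End SpectralRadius.

(** * The matrix exponential and linear differential equations *)

Lemma cvg_mx (R : numFieldType) p q (T : Type) (F : set_system T) {FF : Filter F}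
    (f : T -> 'M[R]_(p, q)) (l : 'M[R]_(p, q)) :
  (forall i j, f x i j @[x --> F] --> l i j) -> f x @[x --> F] --> l.
Proof.
move=> fl U [P Pl sPU]; apply: filterS sPU _.
by apply: filter_forall => i; apply: filter_forall => j; exact: fl (Pl i j).
Qed.

Lemma cvg_coord (R : numFieldType) p q (T : Type) (F : set_system T) {FF : Filter F}
    (f : T -> 'M[R]_(p, q)) (l : 'M[R]_(p, q)) i j :
  f x @[x --> F] --> l -> f x i j @[x --> F] --> l i j.
Proof.
by move=> fl; apply: (cvg_comp _ (fun M : 'M[R]_(p, q) => M i j) fl); exact: coord_continuous.
Qed.

Lemma is_derive_sum_fct (R : realType) (I : finType) (f : I -> R -> R) (df : I -> R) (x : R) :
  (forall i, is_derive x (1 : R) (f i) (df i)) ->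
  is_derive x (1 : R) (fun t => \sum_i f i t) (\sum_i df i).
Proof.
move=> fdf; rewrite (_ : (fun t => _) = \sum_i f i); last first.
  by apply/funext => t; rewrite fct_sumE.
by elim/big_ind2 : _ => [|g1 dg1 g2 dg2 H1 H2|i _]; [exact: is_derive_cst|exact: is_deriveD|].
Qed.

Lemma is_derive_mul (R : realType) (f g : R -> R) (x df dg : R) :
  is_derive x (1 : R) f df -> is_derive x (1 : R) g dg ->
  is_derive x (1 : R) (fun t => f t * g t) (df * g x + f x * dg).
Proof.
move=> Hf Hg; have H := is_deriveM Hf Hg.
apply: (is_derive_eq H); rewrite addrC; congr (_ + _).
by rewrite [LHS]/(g x * df) mulrC.
Qed.

Section Exponential.
Variable R : realType.

Section FactorialSeries.
Variables (c : R^nat) (C L : R).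
Hypothesis (cL : forall k, `|c k| <= C * L ^+ k / k`!%:R).

Lemma factorial_series_cvg x : cvgn (pseries c x).
Proof.
have term_le k : `|c k * x ^+ k| <= (C *: exp_coeff (L * `|x|)) k.
  rewrite normrM normrX; apply: (le_trans (ler_wpM2r _ (cL k))).
    by rewrite exprn_ge0.
  suff -> : (C *: exp_coeff (L * `|x|)) k = C * L ^+ k / k`!%:R * `|x| ^+ k by [].
  by rewrite -[LHS]/(C * ((L * `|x|) ^+ k / k`!%:R)) exprMn; ring.
apply: normed_cvg.
have := is_cvg_seriesZ (k := C) (@is_cvg_series_exp_coeff R (L * `|x|)).
apply: series_le_cvg => [k|k|k] /=; first by [].
- apply: le_trans (normr_ge0 (c k * x ^+ k)) _; exact: term_le.
- exact: term_le.
Qed.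

Lemma factorial_series_diffs k :
  `|pseries_diffs c k| <= (C * L) * L ^+ k / k`!%:R.
Proof.
rewrite /pseries_diffs normrM ger0_norm //.
apply: (le_trans (ler_wpM2l _ (cL k.+1))) => //.
rewrite factS natrM invfM exprS.
have k0 : k.+1%:R != 0 :> R by rewrite pnatr_eq0.
have f0 : k`!%:R != 0 :> R by rewrite pnatr_eq0 -lt0n fact_gt0.
by rewrite le_eqVlt; apply/orP; left; apply/eqP; field; apply/andP; split.
Qed.
End FactorialSeries.

Variable n : nat.
Implicit Types A B : 'M[R]_n.

Local Definition coef A a b (k : nat) : R := k`!%:R^-1 * (A ^+ k) a b.
Local Definition bound A := \sum_a \sum_b `|A a b|.

Local Lemma bound_ge0 A : 0 <= bound A.
Proof. by rewrite sumr_ge0 // => a _; rewrite sumr_ge0. Qed.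

Local Lemma powers_bound A k a b : `|(A ^+ k) a b| <= bound A ^+ k.
Proof.
elim: k a b => [|k IHk] a b.
  by rewrite !expr0 mxE; case: (a == b); rewrite ?normr1 ?normr0.
rewrite !exprS -[_ * _]/(_ *m _) mxE; apply: (le_trans (ler_norm_sum _ _ _)).
apply: (@le_trans _ _ (\sum_c `|A a c| * bound A ^+ k)).
  by apply: ler_sum => c _; rewrite normrM ler_wpM2l.
rewrite -mulr_suml ler_wpM2r ?exprn_ge0 ?bound_ge0 //.
by rewrite /bound [leRHS](bigD1 a) //= lerDl sumr_ge0 // => i _; rewrite sumr_ge0.
Qed.

Local Lemma coef_bound A a b k : `|coef A a b k| <= 1 * bound A ^+ k / k`!%:R.
Proof.
by rewrite mul1r normrM ger0_norm ?invr_ge0 // mulrC ler_wpM2r ?invr_ge0 // powers_bound.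
Qed.

Local Lemma expmx_cvg A a b (x : R) : cvgn (pseries (coef A a b) x).
Proof. exact: factorial_series_cvg (coef_bound A a b) x. Qed.

Lemma expmxE A a b (x : R) : expmx (x *: A) a b = limn (pseries (coef A a b) x).
Proof.
pose E := \matrix_(a, b) limn (pseries (coef A a b) x).
suff /cvg_lim H : series (fun k => k`!%:R^-1 *: (x *: A) ^+ k) @ \oo --> E.
  by rewrite /expmx H ?mxE //; exact: norm_hausdorff.
apply: cvg_mx => i j; rewrite mxE.
rewrite (_ : (fun k => _) = pseries (coef A i j) x); first exact: expmx_cvg.
apply/funext => k; rewrite /pseries /series /= summxE; apply: eq_bigr => l _.
rewrite mxE /coef -mulrA; congr (_ * _); elim: l i j => [|l IHl] i j.
  by rewrite !expr0 mulr1.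
rewrite !exprS -![_ * _ ^+ l]/(_ *m _) !mxE mulr_suml; apply: eq_bigr => d _.
by rewrite IHl mxE; ring.
Qed.

Lemma expmx0 A : expmx (0 *: A) = 1%:M.
Proof.
apply/matrixP => a b; rewrite expmxE.
suff -> : pseries (coef A a b) 0 = fun k => if k is 0%N then 0 else (1%:M : 'M[R]_n) a b.
  by apply/cvg_lim => //; rewrite -(cvg_shiftS _) /=; exact: cvg_cst.
apply/funext => -[|k]; rewrite /pseries /series /=; first by rewrite big_geq.
rewrite big_nat_recl // big1 => [|i _]; last by rewrite expr0n mulr0.
by rewrite /coef !expr0 invr1 mul1r mulr1 addr0.
Qed.

Lemma expmx_ge0 A x : nonneg_mx A -> 0 <= x -> nonneg_mx (expmx (x *: A)).
Proof.
move=> A0 x0 a b; rewrite expmxE; apply: limr_ge; first exact: expmx_cvg.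
apply: nearW => k; rewrite sumr_ge0 // => l _; rewrite mulr_ge0 ?exprn_ge0 //.
rewrite mulr_ge0 ?invr_ge0 //; elim: l a b => [|l IHl] a b.
  by rewrite expr0 mxE; case: (a == b).
by rewrite exprS -[_ * _]/(_ *m _) mxE sumr_ge0 // => c _; rewrite mulr_ge0.
Qed.

Local Lemma coef_diffs A a b : pseries_diffs (coef A a b) =
  fun k => k`!%:R^-1 * (A ^+ k.+1) a b.
Proof.
apply/funext => k; rewrite /pseries_diffs /coef factS natrM invfM.
have k0 : k.+1%:R != 0 :> R by rewrite pnatr_eq0.
by rewrite !mulrA divff // mul1r.
Qed.

Local Lemma lim_pseries_sum (I : finType) (w : I -> R) (c : I -> R^nat) x :
  (forall i, cvgn (pseries (c i) x)) ->
  limn (pseries (fun k => \sum_i w i * c i k) x) = \sum_i w i * limn (pseries (c i) x).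
Proof.
move=> cc; rewrite (_ : pseries _ _ = fun k => \sum_i w i * pseries (c i) x k).
  apply/cvg_lim => //; apply: cvg_big => [|i _]; first exact: add_continuous.
  by apply: cvgMr; exact: cc.
apply/funext => k; rewrite /pseries /series /=.
under eq_bigr do rewrite mulr_suml; rewrite exchange_big; apply: eq_bigr => i _.
by rewrite mulr_sumr; apply: eq_bigr => l _; rewrite mulrA.
Qed.

Local Lemma expmx_is_derive_lim A a b (x : R) : is_derive x (1 : R)
  (fun t => expmx (t *: A) a b) (limn (pseries (pseries_diffs (coef A a b)) x)).
Proof.
under eq_fun do rewrite expmxE.
have d1 := factorial_series_diffs (coef_bound A a b).
have d2 := factorial_series_diffs d1.
apply: (@pseries_snd_diffs _ _ (`|x| + 1)).
- exact: expmx_cvg.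
- exact: factorial_series_cvg d1 _.
- exact: factorial_series_cvg d2 _.
- by rewrite [ltRHS]ger0_norm ?addr_ge0 // ltrDl.
Qed.

Lemma expmx_is_derive A a b (x : R) :
  is_derive x (1 : R) (fun t => expmx (t *: A) a b) ((A *m expmx (x *: A)) a b).
Proof.
apply: is_derive_eq; first exact: expmx_is_derive_lim.
rewrite coef_diffs mxE; under eq_bigr do rewrite expmxE.
rewrite -lim_pseries_sum => [|i]; last exact: expmx_cvg.
congr (limn (pseries _ x)); apply/funext => k.
by rewrite exprS -[_ * _ ^+ _]/(_ *m _) mxE mulr_sumr; apply: eq_bigr => i _; rewrite /coef mulrCA.
Qed.

Lemma expmx_is_derive_r A a b (x : R) :
  is_derive x (1 : R) (fun t => expmx (t *: A) a b) ((expmx (x *: A) *m A) a b).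
Proof.
apply: is_derive_eq; first exact: expmx_is_derive_lim.
rewrite coef_diffs mxE; under eq_bigr do rewrite expmxE mulrC.
rewrite -lim_pseries_sum => [|i]; last exact: expmx_cvg.
congr (limn (pseries _ x)); apply/funext => k.
by rewrite exprSr -[_ ^+ _ * _]/(_ *m _) mxE mulr_sumr; apply: eq_bigr => i _; rewrite /coef; ring.
Qed.

Lemma expmx_is_derive_opp A a b (x : R) :
  is_derive x (1 : R) (fun t => expmx ((- t) *: A) a b)
    (- (expmx ((- x) *: A) *m A) a b).
Proof.
have H := @is_derive1_comp _ (fun t => expmx (t *: A) a b) (fun t => - t) x _ _
  (expmx_is_derive_r A a b (- x)) (is_deriveNid x 1).
by apply: (is_derive_eq H); rewrite mulrN1.
Qed.

Lemma expmxNK A x : expmx ((- x) *: A) *m expmx (x *: A) = 1%:M.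
Proof.
apply/matrixP => a b.
pose f t := (expmx ((- t) *: A) *m expmx (t *: A)) a b.
have -> : 1%:M a b = f 0 by rewrite /f oppr0 !expmx0 mul1mx.
apply: (@is_derive_0_is_cst _ f) => z.
rewrite /f; under eq_fun do rewrite mxE.
apply: is_derive_eq.
  apply: is_derive_sum_fct => c; apply: is_derive_mul.
    exact: expmx_is_derive_opp.
  exact: expmx_is_derive.
rewrite big_split /=.
rewrite (_ : \sum_i - _ * _ = - ((expmx (- z *: A) *m A) *m expmx (z *: A)) a b).
  rewrite -mulmxA addrC; apply/eqP; rewrite subr_eq0; apply/eqP.
  by rewrite [RHS]mxE.
by rewrite [in RHS]mxE -sumrN; apply: eq_bigr => c _; rewrite mulNr.
Qed.

(** The function [e^(-tA) y(t)] has derivative zero. *)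
Lemma linear_ode_unique p A (y : R -> 'M[R]_(n, p)) (t0 t1 : R) :
  (forall t : R, t0 < t < t1 -> forall i j,
     is_derive t (1 : R) (fun s => y s i j) ((A *m y t) i j)) ->
  (forall i j, y s i j @[s --> t0^'+] --> y t0 i j) ->
  forall t, t0 <= t < t1 -> y t = expmx ((t - t0) *: A) *m y t0.
Proof.
move=> yA y0 t /andP[t0t tt1].
suff H : expmx ((- (t - t0)) *: A) *m y t = y t0.
  by rewrite -H mulmxA -{1}(opprK (t - t0)) expmxNK mul1mx.
move: t0t; rewrite le_eqVlt => /predU1P[<-|t0t].
  by rewrite subrr oppr0 expmx0 mul1mx.
apply/matrixP => i j.
pose z s := (expmx ((- (s - t0)) *: A) *m y s) i j.
have -> : y t0 i j = z t0 by rewrite /z subrr oppr0 expmx0 mul1mx.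
have dE (s : R) a b : is_derive s (1 : R) (fun s => expmx ((- (s - t0)) *: A) a b)
    (- (expmx ((- (s - t0)) *: A) *m A) a b).
  have H := @is_derive1_comp _ (fun t => expmx ((- t) *: A) a b) (fun t => t - t0) s _ _
    (expmx_is_derive_opp A a b (s - t0)) (is_derive_shift s 1 (- t0)).
  by apply: (is_derive_eq H); rewrite mulr1.
have dz s : t0 < s < t1 -> is_derive s (1 : R) z 0.
  move=> st; rewrite /z; under eq_fun do rewrite mxE.
  apply: is_derive_eq.
    by apply: is_derive_sum_fct => c; exact: is_derive_mul (dE s i c) (yA s st c j).
  rewrite big_split /=.
  rewrite (_ : \sum_i0 - _ * _ = - ((expmx (- (s - t0) *: A) *m A) *m y s) i j).
    rewrite -mulmxA addrC; apply/eqP; rewrite subr_eq0; apply/eqP.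
    by rewrite [RHS]mxE.
  by rewrite [in RHS]mxE -sumrN; apply: eq_bigr => c _; rewrite mulNr.
have zcont s : t0 < s < t1 -> {for s, continuous z}.
  by move=> /dz [dzs _]; apply/differentiable_continuous/derivable1_diffP.
have : {within `[t0, t], continuous z}.
  apply/continuous_within_itvP => //; split.
  - move=> s; rewrite in_itv /= => /andP[t0s st]; apply: zcont.
    by rewrite t0s (lt_trans st).
  - rewrite /z mxE; under eq_cvg do rewrite mxE.
    apply: cvg_big => [|c _]; first exact: add_continuous.
    apply: cvgM; last exact: y0.
    apply: cvg_at_right_filter.
    by have [dEs _] := dE t0 i c; apply/differentiable_continuous/derivable1_diffP.
  - by apply: cvg_at_left_filter; apply: zcont; rewrite t0t tt1.
move=> zc; have [|c _] := MVT t0t (df := fun=> 0) _ zc.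
  move=> s; rewrite in_itv /= => /andP[t0s st]; apply: dz.
  by rewrite t0s (lt_trans st).
by rewrite mul0r => /eqP; rewrite subr_eq0 => /eqP.
Qed.

(** With [c] large enough that [A + c] is nonnegative, [e^(tA)] is the product of
    [e^(-ct)] and [e^(t(A + c))], as both solve the same equation. *)
Lemma expmx_metzler_ge0 A x : metzler A -> 0 <= x -> nonneg_mx (expmx (x *: A)).
Proof.
move=> mA x0; pose c : R := \sum_i `|A i i|; pose B := A + c%:M.
have B0 : nonneg_mx B.
  move=> i j; rewrite !mxE; have [<-|ij] := eqVneq i j; last first.
    by rewrite addr0 mA.
  rewrite mulr1n /c (bigD1 i) //= addrA addr_ge0 ?sumr_ge0 //.
  by rewrite addrC -lerBlDr sub0r -normrN ler_norm.
suff <- : expR (- c * x) *: expmx (x *: B) = expmx (x *: A).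
  by move=> i j; rewrite mxE mulr_ge0 ?expR_ge0 // expmx_ge0.
pose y (s : R) : 'M[R]_n := expR (- c * s) *: expmx (s *: B).
have dy (s : R) i j : is_derive s (1 : R) (fun s => y s i j) ((A *m y s) i j).
  rewrite /y; under eq_fun do rewrite mxE.
  have He : is_derive s (1 : R) (fun s => expR (- c * s)) (expR (- c * s) * (- c)).
    have Hl := is_derive_mul (is_derive_cst (- c) s 1) (is_derive_id s 1).
    have H := @is_derive1_comp _ expR (fun t => - c * t) s _ _ (is_derive_expR _) Hl.
    by apply: (is_derive_eq H); rewrite mul0r add0r mulr1.
  apply: is_derive_eq; first exact: is_derive_mul He (expmx_is_derive B i j s).
  rewrite -scalemxAr /B mulmxDl mul_scalar_mx !mxE; ring.
have -> : expR (- c * x) *: expmx (x *: B) = y x by [].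
rewrite (@linear_ode_unique _ A y 0 (x + 1)).
- by rewrite subr0 /y mulr0 expR0 expmx0 scale1r mulmx1.
- move=> i j; apply: cvg_at_right_filter.
  by have [dys _] := dy 0 i j; apply/differentiable_continuous/derivable1_diffP.
- by apply/andP; split=> //; rewrite ltrDl.
Qed.

Lemma expmx_continuous A a b : continuous (fun t : R => expmx (t *: A) a b).
Proof.
move=> t; have [d _] := expmx_is_derive A a b t.
exact/differentiable_continuous/derivable1_diffP.
Qed.

Lemma expmx_bounded A (T : R) :
  exists2 C, 0 < C & forall t a b, `|t| <= T -> `|expmx (t *: A) a b| <= C.
Proof.
have [T0|T0] := ltP T 0.
  by exists 1 => // t a b /le_lt_trans /(_ T0); rewrite normr_lt0.
have H a b : exists2 C, 0 <= C & forall t, `|t| <= T -> `|expmx (t *: A) a b| <= C.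
  have [||c _ Hc] := @EVT_max R (fun t => `|expmx (t *: A) a b|) (- T) T.
  - by rewrite ge0_cp.
  - apply: continuous_subspaceT => t; apply: cvg_norm; exact: expmx_continuous.
  exists `|expmx (c *: A) a b| => // t tT; apply: Hc.
  by rewrite in_itv /= -ler_norml.
pose C (ab : 'I_n * 'I_n) := s2val (cid2 (H ab.1 ab.2)).
have C0 ab : 0 <= C ab by rewrite /C; case: cid2.
exists (1 + \sum_ab C ab); first by rewrite ltr_pwDl // sumr_ge0.
move=> t a b tT; apply: (@le_trans _ _ (C (a, b))).
  by rewrite /C; case: cid2 => /= C' _ ->.
by rewrite (bigD1 (a, b)) //= addrCA lerDl addr_ge0 // sumr_ge0.
Qed.

End Exponential.

(** * The lift of a matrix to degree-[m] monomials *)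

Section Monomials.
Variables n m : nat.

Lemma mem_monomials k d (e : seq nat) :
  (e \in monomials k d) = (size e == k) && (sumn e == d).
Proof.
elim: k d e => [|k IHk] d e.
  by case: d e => [|d] [|a e] //=.
rewrite /= -/(iota 0 d.+1); apply/flatten_mapP/andP => [[a]|].
  rewrite mem_rev mem_iota add0n ltnS => /= ad /mapP[e' + ->].
  by rewrite IHk => /andP[/eqP <- /eqP /= ->]; rewrite subnKC.
case: e => [|a e] [] //= /eqP[ek] /eqP ed.
rewrite -/(iota 0 d.+1); exists a; first by rewrite mem_rev mem_iota add0n ltnS -ed leq_addr.
by apply/mapP; exists e => //; rewrite IHk ek -ed addKn !eqxx.
Qed.

Lemma uniq_monomials k d : uniq (monomials k d).
Proof.
elim: k d => [|k IHk] d; first by case: d.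
rewrite /= -/(iota 0 d.+1); apply: (@allpairs_uniq_dep _ (fun=> seq nat) _ (fun a e => a :: e)).
- by rewrite rev_uniq iota_uniq.
- by move=> a _; exact: IHk.
- by move=> [a e] [b f] _ _ /= [-> ->].
Qed.

Definition expo (a : 'I_(lift_dim n m)) : seq nat := nth [::] (monomials n m) a.

Lemma expo_mem a : expo a \in monomials n m.
Proof. by rewrite mem_nth // size_monomials. Qed.

Lemma size_expo a : size (expo a) = n.
Proof. by have := expo_mem a; rewrite mem_monomials => /andP[/eqP]. Qed.

Lemma sumn_expo a : sumn (expo a) = m.
Proof. by have := expo_mem a; rewrite mem_monomials => /andP[_ /eqP]. Qed.

Lemma expo_inj : injective expo.
Proof.
move=> a b /eqP; rewrite nth_uniq ?size_monomials ?uniq_monomials // => /eqP.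
exact: val_inj.
Qed.

Lemma expo_surj e : size e = n -> sumn e = m -> exists a, expo a = e.
Proof.
move=> en em; have mem_e : e \in monomials n m by rewrite mem_monomials en em !eqxx.
have lt_e : (index e (monomials n m) < lift_dim n m)%N.
  by rewrite -size_monomials index_mem.
by exists (Ordinal lt_e); rewrite /expo nth_index.
Qed.

(** A monomial of degree [m] is a product of [m] variables, given by a word; the
    expansion of a product of sums is indexed by words. *)
Definition word := {ffun 'I_m -> 'I_n}.

Definition letter_count (w : word) (l : 'I_n) : nat := #|[pred t | w t == l]|.

Lemma word_of_expo a : exists w : word, forall l, letter_count w l = nth 0%N (expo a) l.
Proof.
pose s : seq 'I_n := flatten [seq nseq (nth 0%N (expo a) l) l | l : 'I_n <- enum 'I_n].
have sm : size s == m.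
  rewrite size_flatten /shape -map_comp -[X in _ == X](sumn_expo a); apply/eqP.
  congr sumn; apply: (@eq_from_nth _ 0%N).
    by rewrite size_map size_expo size_enum_ord.
  move=> i; rewrite size_map size_enum_ord => lt_in.
  by rewrite (nth_map (Ordinal lt_in)) ?size_enum_ord //= size_nseq nth_enum_ord.
pose w : word := [ffun t => tnth (Tuple sm) t].
exists w => l; rewrite /letter_count.
have -> : #|[pred t | w t == l]| = count (pred1 l) s.
  rewrite -[s]/(tval (Tuple sm)) -(map_tnth_enum (Tuple sm)) count_map cardE.
  rewrite enumT /enum_mem size_filter; apply: eq_count => t /=.
  by rewrite inE /= ffunE.
rewrite /s count_flatten -map_comp sumnE big_map big_enum /=.
rewrite (bigD1 l) //= big1 => [|j jl]; first by rewrite count_nseq /= eqxx mul1n addn0.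
by rewrite count_nseq /= (negbTE jl).
Qed.

Lemma expo_of_word (w : word) : exists a, forall l : 'I_n, nth 0%N (expo a) l = letter_count w l.
Proof.
have [||a ea] := @expo_surj [seq letter_count w l | l <- enum 'I_n].
- by rewrite size_map size_enum_ord.
- rewrite sumnE big_map big_enum /= -[RHS](card_ord m) -sum1_card.
  rewrite [RHS](partition_big w predT) //=; apply: eq_bigr => l _.
  by rewrite /letter_count -sum1_card; apply: eq_bigl => t; rewrite inE.
exists a => l; rewrite ea (nth_map l) ?size_enum_ord //.
by congr letter_count; apply: val_inj; rewrite /= nth_enum_ord.
Qed.

Definition expo_word a : word := projT1 (cid (word_of_expo a)).
Definition word_expo (w : word) : 'I_(lift_dim n m) := projT1 (cid (expo_of_word w)).

Variable R : realType.
Implicit Types (x : 'cV[R]_n) (A B : 'M[R]_n).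

Lemma prod_word x (w : word) : \prod_t x (w t) 0 = \prod_l x l 0 ^+ letter_count w l.
Proof.
rewrite (partition_big w predT) //=; apply: eq_bigr => l _.
rewrite (eq_bigr (fun=> x l 0)) => [|t /eqP -> //].
by rewrite prodr_const; congr (_ ^+ _); apply: eq_card => t; rewrite !inE.
Qed.

Definition mono_coef (a : 'I_(lift_dim n m)) : R :=
  Num.sqrt (m`!%:R / (\prod_(e <- expo a) e`!)%:R).

Lemma mono_coef_gt0 a : 0 < mono_coef a.
Proof.
rewrite sqrtr_gt0 divr_gt0 ?ltr0n ?fact_gt0 //.
by rewrite prodn_gt0 // => e; rewrite fact_gt0.
Qed.

Lemma lift_vecE x a : lift_vec m x a 0 = mono_coef a * \prod_l x l 0 ^+ nth 0%N (expo a) l.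
Proof. by rewrite mxE. Qed.

Lemma lift_vec_word x a : lift_vec m x a 0 = mono_coef a * \prod_t x (expo_word a t) 0.
Proof.
rewrite lift_vecE prod_word /expo_word; case: cid => w /= ww.
by congr (_ * _); apply: eq_bigr => l _; rewrite ww.
Qed.

Lemma prod_word_lift x (w : word) :
  \prod_t x (w t) 0 = (mono_coef (word_expo w))^-1 * lift_vec m x (word_expo w) 0.
Proof.
rewrite lift_vecE mulKf ?gt_eqF ?mono_coef_gt0 // prod_word /word_expo.
by case: cid => a /= aw; apply: eq_bigr => l _; rewrite aw.
Qed.

Definition lift_poly A : 'M[R]_(lift_dim n m) := \matrix_(a, b)
  \sum_(w : word | word_expo w == b)
     (mono_coef a / mono_coef b) * \prod_t A (expo_word a t) (w t).

Lemma lift_polyP A x : lift_vec m (A *m x) = lift_poly A *m lift_vec m x.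
Proof.
apply/colP => a; rewrite lift_vec_word mxE.
under eq_bigr do rewrite mxE; rewrite bigA_distr_bigA /=.
rewrite (partition_big word_expo predT) //= mulr_sumr; apply: eq_bigr => b _.
rewrite mxE mulr_suml mulr_sumr; apply: eq_bigr => w /eqP wb.
rewrite big_split /= prod_word_lift wb; ring.
Qed.

(** Substituting [x_l = y ^ ((m + 1) ^ l)] turns distinct monomials of degree [m]
    into distinct powers of [y]. *)
Definition kronecker (e : seq nat) : nat := foldr (fun a k => a + m.+1 * k)%N 0%N e.

Lemma kronecker_inj e f : size e = size f -> all (leq^~ m) e -> all (leq^~ m) f ->
  kronecker e = kronecker f -> e = f.
Proof.
elim: e f => [|a e IHe] [|b f] //= [ef] /andP[am em] /andP[bm fm] abef.
have ab : a = b.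
  have := congr1 (modn^~ m.+1) abef.
  by rewrite !(mulnC m.+1) addnC (addnC b) !modnMDl !modn_small.
move: abef; rewrite ab => /addnI /eqP; rewrite eqn_pmul2l // => /eqP /IHe -> //.
Qed.

Lemma prod_kronecker (y : R) (e : seq nat) :
  \prod_(l < size e) (y ^+ (m.+1 ^ l)) ^+ nth 0%N e l = y ^+ kronecker e.
Proof.
elim: e => [|a e IHe]; first by rewrite big_ord0 expr0.
rewrite big_ord_recl /= expn0 expr1 exprD; congr (_ * _).
rewrite mulnC exprM -IHe -prodrXl; apply: eq_bigr => l _.
by rewrite /bump /= add1n expnS add0n -!exprM -mulnA mulnC.
Qed.

Lemma poly_everywhere0 (p : {poly R}) : (forall y, p.[y] = 0) -> p = 0.
Proof.
move=> p0; apply/eqP; apply: contraT => /max_poly_roots max_roots.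
have := max_roots [seq i%:R | i <- iota 0 (size p)].
rewrite size_map size_iota ltnn => -> //.
  by apply/allP => y _; rewrite rootE p0.
by rewrite map_inj_uniq ?iota_uniq // => i j /eqP; rewrite eqr_nat => /eqP.
Qed.

Lemma lift_vec_separating k (M : 'M[R]_(k, lift_dim n m)) :
  (forall x, M *m lift_vec m x = 0) -> M = 0.
Proof.
move=> M0; apply/matrixP => i b; rewrite [RHS]mxE.
pose p : {poly R} := \sum_b (M i b * mono_coef b) *: 'X^(kronecker (expo b)).
have kron_inj : injective (kronecker \o expo).
  move=> c d /= cd; apply: expo_inj; apply: kronecker_inj cd.
  - by rewrite !size_expo.
  - by apply/allP => a ac; rewrite -(sumn_expo c) sumnE (big_rem a) //= leq_addr.
  - by apply/allP => a ac; rewrite -(sumn_expo d) sumnE (big_rem a) //= leq_addr.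
have p0 : p = 0.
  apply: poly_everywhere0 => y; rewrite /p horner_sum.
  pose x : 'cV[R]_n := \col_l y ^+ (m.+1 ^ l).
  have : (M *m lift_vec m x) i 0 = 0 by rewrite M0 mxE.
  rewrite mxE => Mx; rewrite -[RHS]Mx; apply: eq_bigr => c _.
  rewrite hornerZ hornerXn lift_vecE -mulrA; congr (_ * (_ * _)).
  rewrite -prod_kronecker size_expo; apply: eq_bigr => l _.
  by rewrite mxE.
have := congr1 (fun q : {poly R} => q`_(kronecker (expo b))) p0.
rewrite /p coef0 coef_sum (bigD1 b) //= big1 => [|c cb].
  rewrite coefZ coefXn eqxx mulr1 addr0 => /eqP.
  by rewrite mulf_eq0 (gt_eqF (mono_coef_gt0 b)) orbF => /eqP.
rewrite coefZ coefXn; have [/kron_inj bc|] := eqVneq (kronecker (expo b)) _.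
  by rewrite bc eqxx in cb.
by rewrite mulr0.
Qed.

(** [lift_mx] is chosen among the matrices with this property, and there is only one. *)
Lemma lift_mx_eq A (M : 'M[R]_(lift_dim n m)) :
  (forall x, lift_vec m (A *m x) = M *m lift_vec m x) -> lift_mx m A = M.
Proof.
move=> MP; rewrite /lift_mx; apply/eqP; rewrite -subr_eq0; apply/eqP.
apply: lift_vec_separating => x; rewrite mulmxBl -MP.
have := xgetPex (0 : 'M[R]_(lift_dim n m)) (ex_intro (fun M =>
  forall x, lift_vec m (A *m x) = M *m lift_vec m x) M MP).
by move=> <-; rewrite subrr.
Qed.

Lemma lift_mxE A : lift_mx m A = lift_poly A.
Proof. by apply: lift_mx_eq => x; exact: lift_polyP. Qed.

Lemma lift_vec_mulmx A x : lift_vec m (A *m x) = lift_mx m A *m lift_vec m x.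
Proof. by rewrite lift_mxE lift_polyP. Qed.

Lemma lift_mxM A B : lift_mx m (A *m B) = lift_mx m A *m lift_mx m B.
Proof. by apply: lift_mx_eq => x; rewrite -!mulmxA !lift_vec_mulmx. Qed.

Lemma lift_mx1 : lift_mx m 1%:M = 1%:M :> 'M[R]_(lift_dim n m).
Proof. by apply: lift_mx_eq => x; rewrite !mul1mx. Qed.

Lemma lift_mx_ge0 A : nonneg_mx A -> nonneg_mx (lift_mx m A).
Proof.
move=> A0 a b; rewrite lift_mxE mxE sumr_ge0 // => w _.
by rewrite mulr_ge0 ?prodr_ge0 // divr_ge0 // ltW // mono_coef_gt0.
Qed.

Lemma lift_vec_ge0 x a : (forall l, 0 <= x l 0) -> 0 <= lift_vec m x a 0.
Proof.
by move=> x0; rewrite lift_vec_word mulr_ge0 ?prodr_ge0 // ltW // mono_coef_gt0.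
Qed.

Lemma lift_vec_const1_gt0 b : 0 < lift_vec m (const_mx 1 : 'cV[R]_n) b 0.
Proof.
by rewrite lift_vec_word mulr_gt0 ?mono_coef_gt0 // prodr_gt0 // => t _; rewrite mxE.
Qed.

Lemma coord_le_norm p q (M : 'M[R]_(p, q)) i j : `|M i j| <= `|M|.
Proof.
rewrite [leRHS]/Num.norm /= mx_normrE.
exact: (le_bigmax _ (fun ij : 'I_p * 'I_q => `|M ij.1 ij.2|) (i, j)).
Qed.

Lemma norm_le_coord p q (M : 'M[R]_(p, q)) c :
  0 <= c -> (forall i j, `|M i j| <= c) -> `|M| <= c.
Proof.
move=> c0 Mc; rewrite [leLHS]/Num.norm /= mx_normrE; apply/bigmax_leP.
by split=> // -[i j] _; exact: Mc.
Qed.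

Definition lift_const : R := \sum_a (mono_coef a + (mono_coef a)^-1).

Lemma lift_const_ge a : mono_coef a + (mono_coef a)^-1 <= lift_const.
Proof.
rewrite /lift_const (bigD1 a) //= lerDl sumr_ge0 // => b _.
by rewrite addr_ge0 ?invr_ge0 // ltW // mono_coef_gt0.
Qed.

Lemma lift_const_ge0 : 0 <= lift_const.
Proof. by rewrite sumr_ge0 // => b _; rewrite addr_ge0 ?invr_ge0 // ltW // mono_coef_gt0. Qed.

Lemma lift_vec_le_norm x a : `|lift_vec m x a 0| <= lift_const * `|x| ^+ m.
Proof.
rewrite lift_vec_word normrM ger0_norm ?(ltW (mono_coef_gt0 a)) //.
apply: ler_pM => //; first exact: ltW (mono_coef_gt0 a).
  apply: le_trans (lift_const_ge a).
  by rewrite lerDl invr_ge0 ltW ?mono_coef_gt0.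
rewrite normr_prod; apply: (@le_trans _ _ (\prod_(t < m) `|x|)).
  by apply: ler_prod => t _; rewrite normr_ge0 coord_le_norm.
by rewrite prodr_const card_ord.
Qed.

Lemma norm_le_lift_vec x : (0 < m)%N -> `|x| ^+ m <= lift_const * \sum_a `|lift_vec m x a 0|.
Proof.
move=> m0; have S0 : 0 <= lift_const * \sum_a `|lift_vec m x a 0|.
  by rewrite mulr_ge0 ?lift_const_ge0 // sumr_ge0.
have [/eqP x0|x0] := eqVneq (mx_norm x) 0.
  have -> : `|x| = 0 by exact: (eqP x0).
  by rewrite expr0n gtn_eqF.
have [[l j] /= xl] := mx_norm_neq0 x0; rewrite (ord1 j) in xl.
have -> : `|x| = `|x l 0| by exact: xl.
rewrite -normrX; pose w : word := [ffun=> l].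
have -> : x l 0 ^+ m = \prod_t x (w t) 0.
  by rewrite (eq_bigr (fun=> x l 0)) ?prodr_const ?card_ord // => t _; rewrite ffunE.
rewrite prod_word_lift normrM; apply: ler_pM => //.
  rewrite ger0_norm ?invr_ge0 ?(ltW (mono_coef_gt0 _)) //.
  apply: le_trans (lift_const_ge (word_expo w)).
  by rewrite lerDr ltW ?mono_coef_gt0.
by rewrite (bigD1 (word_expo w)) //= lerDl sumr_ge0.
Qed.

End Monomials.

(** * Factorization of integrals *)

Section Law.
Local Open Scope ereal_scope.
Context d1 d2 (S : measurableType d1) (Y : measurableType d2) (R : realType).
Variables (P : probability S R) (D : set S) (mD : measurable D).
Variables (f : S -> Y) (mf : measurable_fun setT f).

(** The image under [f] of the restriction of [P] to [D]. The proof of measurability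
    is an argument of the function, so that the measure structure attaches to it. *)
Definition law_on & measurable_fun setT f : set Y -> \bar R :=
  pushforward (mrestr P mD) f.

Local Notation lawD := (law_on mf).

Let preimage_meas U : measurable U -> measurable (f @^-1` U).
Proof. by move=> mU; rewrite -[X in measurable X]setTI; exact: mf. Qed.

Let law0 : lawD set0 = 0.
Proof. by rewrite /law_on /pushforward preimage_set0 measure0. Qed.

Let law_ge0 U : 0 <= lawD U.
Proof. exact: measure_ge0. Qed.

Let law_sigma_additive : semi_sigma_additive lawD.
Proof.
move=> F mF tF mUF; rewrite /law_on /pushforward preimage_bigcup.
apply: (@measure_semi_sigma_additive _ _ _ (mrestr P mD)).
- by move=> p; exact: preimage_meas.
- apply/trivIsetP => /= p q _ _ pq; rewrite -preimage_setI.
  by move/trivIsetP : tF => /(_ _ _ _ _ pq) -> //; rewrite preimage_set0.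
- by rewrite -preimage_bigcup; exact: preimage_meas.
Qed.

HB.instance Definition _ := isMeasure.Build _ _ _ lawD law0 law_ge0 law_sigma_additive.

Let law_fin : fin_num_fun lawD.
Proof.
move=> U mU; have mfU := preimage_meas mU.
rewrite /law_on /pushforward /mrestr ge0_fin_numE ?measure_ge0 //.
apply: (@le_lt_trans _ _ (P setT)); last by rewrite probability_setT ltry.
by apply: le_measure => //; rewrite inE //; exact: measurableI.
Qed.

HB.instance Definition _ := Measure_isFinite.Build _ _ _ lawD law_fin.

Lemma ge0_integral_law_on (phi : Y -> \bar R) : measurable_fun [set: Y] phi ->
  (forall y, 0 <= phi y) -> \int[lawD]_y phi y = \int[P]_(x in D) phi (f x).
Proof.
move=> mphi phi0; rewrite (@ge0_integral_pushforward _ _ _ _ _ f mf (mrestr P mD)) //.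
have mphif : measurable_fun setT (phi \o f) by exact: measurableT_comp.
rewrite preimage_setT.
rewrite (@ge0_negligible_integral _ _ _ (mrestr P mD) setT (~` D)) //.
- rewrite setTD setCK; apply: eq_measure_integral => A mA AD.
  by rewrite /= /mrestr setIidl.
- exact: measurableC.
- by move=> x _; exact: phi0.
- by rewrite /= /mrestr setICl measure0.
Qed.

End Law.

(** The last hypothesis says that the joint law of [(g, q1)] on [E1] is the product of
    the law of [g] on [E2] and the law of [q2] on [E3]; the conclusion is
    Tonelli's theorem for this product. *)
Lemma ge0_integral_factor d1 d2 d3 (S1 : measurableType d1) (S2 : measurableType d2)
    (Y : measurableType d3) (R : realType) (P1 : probability S1 R) (P2 : probability S2 R)
    (E1 E2 : set S1) (E3 : set S2) (g : S1 -> R) (q1 : S1 -> Y) (q2 : S2 -> Y)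
    (phi : Y -> R) :
  measurable E1 -> measurable E2 -> measurable E3 ->
  measurable_fun setT g -> measurable_fun setT q1 -> measurable_fun setT q2 ->
  measurable_fun [set: Y] phi -> (forall x, 0 <= g x) -> (forall y, 0 <= phi y) ->
  (forall A B, measurable A -> measurable B ->
     P1 (g @^-1` A `&` q1 @^-1` B `&` E1) =
     P1 (g @^-1` A `&` E2) * P2 (q2 @^-1` B `&` E3))%E ->
  (\int[P1]_(x in E1) (g x * phi (q1 x))%:E =
   \int[P1]_(x in E2) (g x)%:E * \int[P2]_(x in E3) (phi (q2 x))%:E)%E.
Proof.
move=> mE1 mE2 mE3 mg mq1 mq2 mphi g0 phi0 fact.
have mgq : measurable_fun [set: S1] ((fun x => (g x, q1 x)) : S1 -> (R * Y)%type).
  exact/measurable_fun_pairP.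
pose F (z : R * Y) : \bar R := (`|z.1| * phi z.2)%:E.
have mF : measurable_fun [set: R * Y] F.
  apply/measurable_EFinP; apply: measurable_funM; last exact: measurableT_comp.
  by apply: measurableT_comp => //; exact: measurable_fst.
have F0 z : (0 <= F z)%E by rewrite lee_fin mulr_ge0.
transitivity (\int[law_on P1 mE1 mgq]_z F z)%E.
  rewrite ge0_integral_law_on //; apply: eq_integral => x _.
  by rewrite /F /= ger0_norm.
pose m1 : {finite_measure set _ -> \bar R} := law_on P1 mE2 mg.
pose m2 : {finite_measure set _ -> \bar R} := law_on P2 mE3 mq2.
transitivity (\int[m1 \x m2]_z F z)%E.
  apply/esym/eq_measure_integral => A mA _.
  by apply: product_measure_unique => // B C mB mC; exact: fact.
rewrite fubini_tonelli1 // /fubini_F.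
pose I := (\int[m2]_y (phi y)%:E)%E.
have I0 : (0 <= I)%E by apply: integral_ge0 => y _; rewrite lee_fin.
transitivity (\int[m1]_x (`|x|%:E * I))%E.
  apply: eq_integral => x _; rewrite /F /=.
  under eq_integral do rewrite EFinM.
  rewrite ge0_integralZl_EFin //; last exact/measurable_EFinP.
  by move=> y _; rewrite lee_fin.
have mabs : measurable_fun [set: R] (fun x : R => `|x|%:E).
  by apply/measurable_EFinP; exact: normr_measurable.
rewrite ge0_integralZr //; congr (_ * _)%E.
  rewrite ge0_integral_law_on //.
  by apply: eq_integral => x _; rewrite ger0_norm.
rewrite /I ge0_integral_law_on //; first exact/measurable_EFinP.
Qed.

(** The matrices as a measurable type with measurable sets [borel_mx]. *)
Definition borel_mat (R : realType) p q :=
  g_sigma_algebraType [set U : set 'M[R]_(p, q) | open U].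

(** The transition law is given through the events [h_k <= u], so products with a
    ray as first factor have to generate the product sigma-algebra. *)
Lemma prod_ray_measurable d (Y : measurableType d) (R : realType) :
  @measurable _ (R * Y)%type =
  <<s [set E | exists (u : R) (B : set Y), measurable B /\ E = [set x | x <= u] `*` B] >>.
Proof.
set G := [set E | _]; apply/seteqP; split; last first.
  apply: smallest_sub; first exact: sigma_algebra_measurable.
  move=> _ [u [B [mB ->]]]; apply: measurableX => //.
  by rewrite -set_itvNyc.
rewrite measurable_prod_measurableType; apply: smallest_sub.
  exact: smallest_sigma_algebra.
pose GT : measurableType _ := g_sigma_algebraType G.
have cover : \bigcup_k [set x : R | x <= k%:R] = setT.
  apply/seteqP; split=> // x _; exists (Num.bound `|x|) => //=.
  by apply: (le_trans (ler_norm x)); apply: ltW; apply: archi_boundP.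
have mfst : measurable_fun (setT : set GT) (fst : GT -> R).
  apply: (measurability _ (RGenOInfty.measurableE R)) => _ [_ [x ->] <-].
  rewrite setTI (_ : fst @^-1` _ = ~` ([set y | y <= x] `*` setT)).
    apply: measurableC; apply: sub_sigma_algebra; exists x, setT; split=> //.
  apply/seteqP; split=> -[y b] /=; rewrite in_itv /= andbT ltNge.
    by move=> /negP yx [].
  by move=> yx; apply/negP => xy; apply: yx.
have msnd : measurable_fun (setT : set GT) (snd : GT -> Y).
  move=> _ B mB; rewrite setTI (_ : snd @^-1` B = \bigcup_k ([set x : R | x <= k%:R] `*` B)).
    apply: bigcup_measurable => k _; apply: sub_sigma_algebra.
    by exists k%:R, B.
  by rewrite -setX_bigcupl // cover; apply/seteqP; split=> -[x y] //= [].
move=> _ [A mA [B mB <-]].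
rewrite (_ : A `*` B = (fst @^-1` A) `&` (snd @^-1` B)) //.
rewrite -[_ @^-1` A]setTI -[_ @^-1` B]setTI.
apply: (@measurableI _ GT); [exact: mfst|exact: msnd].
Qed.

(** * The semi-Markov property *)

(** The generators in [sigma_history], named so that they can carry a measurable type. *)
Definition history_gen (R : realType) N n (Z : switching R N n) k : set (set (Omega Z)) :=
  [set D | [\/ exists l i, (l <= k)%N /\ D = mode_is l i,
               exists l Y, [/\ (l <= k)%N, measurable Y & D = time l @^-1` Y]
             | exists l B, [/\ (l < k)%N, borel_mx B & D = reset l @^-1` B]]].
Arguments history_gen {R N n} Z k _.

(** The sample space with the sigma-algebra of the history, so that functions that
    depend on the history only are functions that are measurable on this space. *)
Notation history_space Z k := (g_sigma_algebraType (history_gen Z k)).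

Section SemiMarkov.
Context (R : realType) (N n : nat) (X : 'I_N -> switching R N n).
Hypothesis smX : semi_markovian X.

Lemma sigma_mode_const (Z : switching R N n) k i D : sigma_mode Z k D ->
  mode_is k i `<=` D \/ mode_is k i `<=` ~` D.
Proof.
move: D; apply: smallest_sub; last first.
  move=> _ [i' ->]; have [->|ii'] := eqVneq i i'; [by left|right=> w wi wi'].
  by move: ii'; rewrite -wi -wi' eqxx.
split.
- by right=> w _ [].
- by move=> D [H|H]; [right => w /H Dw [_]; exact|left => w /H].
- move=> F H; have [[p Fp]|nF] := pselect (exists p, mode_is k i `<=` F p).
    by left=> w wi; exists p => //; exact: Fp.
  right=> w wi [p _ Fpw]; have [Hp|/(_ _ wi)] := H p; last exact.
  by apply: nF; exists p.
Qed.

Lemma mode0 s : @mode_is _ _ _ (X s) 0 s = setT.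
Proof. by have [m0 _ _] := smX; apply/seteqP; split=> // w _; exact: m0. Qed.

Lemma measurable_mode_is (Z : switching R N n) k i : measurable (@mode_is _ _ _ Z k i).
Proof. exact: measurable_mode. Qed.

Lemma history_measurable (Z : switching R N n) k D : sigma_history Z k D -> measurable D.
Proof.
move: D; apply: smallest_sub; first exact: sigma_algebra_measurable.
move=> D [[l [i [_ ->]]]|[l [Y [_ mY ->]]]|[l [B [_ mB ->]]]].
- exact: measurable_mode.
- by rewrite -[_ @^-1` _]setTI; exact: measurable_time.
- exact: measurable_reset.
Qed.

Lemma history_mode (Z : switching R N n) k i : sigma_history Z k (mode_is k i).
Proof. by apply: sub_sigma_algebra; apply: Or31; exists k, i. Qed.

Lemma holding_ge0 (Z : switching R N n) k w : 0 <= @holding _ _ _ Z k w.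
Proof. by rewrite subr_ge0 time_nondecreasing. Qed.

Lemma measurable_holding (Z : switching R N n) k : measurable_fun setT (@holding _ _ _ Z k).
Proof. by apply: measurable_funB; exact: measurable_time. Qed.

Lemma measurable_reset_fun (Z : switching R N n) k :
  measurable_fun setT (reset k : Omega Z -> borel_mat R n n).
Proof. by move=> _ B mB; rewrite setTI; exact: measurable_reset. Qed.

Lemma measurable_holding_reset (Z : switching R N n) k :
  measurable_fun [set: Omega Z]
    ((fun w => (holding k w, reset k w)) : Omega Z -> R * borel_mat R n n).
Proof.
by apply/measurable_fun_pairP; split; [exact: measurable_holding|exact: measurable_reset_fun].
Qed.

Lemma measurable_holding_ge (Z : switching R N n) k (delta : R) :
  measurable [set w : Omega Z | delta <= holding k w].
Proof.
rewrite (_ : [set w | _] = holding k @^-1` `[delta, +oo[%classic); last first.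
  by apply/seteqP; split=> w /=; rewrite in_itv /= andbT.
by rewrite -[_ @^-1` _]setTI; exact: measurable_holding.
Qed.

Lemma measurable_transition (Z : switching R N n) k j u B : borel_mx B ->
  measurable (@transition _ _ _ Z k j u B).
Proof.
move=> mB; rewrite (_ : transition _ _ _ _ = mode_is k.+1 j `&`
    (holding k @^-1` `]-oo, u]%classic) `&` (reset k @^-1` B)); last first.
  apply/seteqP; split=> w /=; first by case=> ? ? ?; rewrite in_itv.
  by case=> -[? +] ?; rewrite in_itv.
apply: measurableI; last exact: measurable_reset.
apply: measurableI; first exact: measurable_mode.
by rewrite -[_ @^-1` _]setTI; exact: measurable_holding.
Qed.

(** The conditional probability given the history is measurable for the current
    mode, hence constant on each of its values. *)
Lemma history_transition s k G j i u B : sigma_history (X s) k G -> borel_mx B ->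
  (Prob (X s) (G `&` mode_is k j `&` transition k i u B) =
   Prob (X s) (G `&` mode_is k j) * Prob (X j) (transition 0 i u B))%E.
Proof.
move=> hG mB; have [u0|u0] := ltP u 0.
  have T0 Z l : @transition _ _ _ Z l i u B = set0.
    apply/seteqP; split=> w //= [_ hu _].
    by have := le_lt_trans (holding_ge0 l w) (le_lt_trans hu u0); rewrite ltxx.
  by rewrite !T0 setI0 !measure0 mule0.
have [m0 cond homog] := smX.
have [f [[_ _ fhist] [fmode _ fint]]] := cond s k i u B u0 mB.
have mT : measurable (@transition _ _ _ (X s) k i u B) by exact: measurable_transition.
have mG := history_measurable hG; have mM := measurable_mode_is (X s) k j.
have hGM : sigma_history (X s) k (G `&` mode_is k j).
  have H : (history_gen (X s) k).-sigma.-measurable (G `&` mode_is k j) :=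
    @measurableI _ (history_space (X s) k) _ _ hG (history_mode j).
  exact: H.
have [c fc] : exists c, forall w, mode_is k j w -> f w = c.
  have [M0|/set0P[w0 w0j]] := eqVneq (@mode_is _ _ _ (X s) k j) set0.
    by exists 0 => w; rewrite M0.
  exists (f w0) => w wj.
  have := sigma_mode_const j (fmode [set f w0] (measurable_set1 _)).
  by case=> /(_ _); [move/(_ w wj)|move/(_ w0 w0j)/(_ erefl)].
have fI D : measurable D -> D `<=` mode_is k j ->
    (\int[Prob (X s)]_(w in D) (f w)%:E = c%:E * Prob (X s) D)%E.
  move=> mD Dj; rewrite (eq_integral (cst c%:E)) ?integral_cst //.
  by move=> w /[!inE] /Dj /fc ->.
have cM : (c%:E * Prob (X s) (mode_is k j) = Prob (X s) (mode_is k j `&` transition k i u B))%E.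
  rewrite -fI // fint //; exact: sub_sigma_algebra (ex_intro _ j erefl).
rewrite -fhist // fI //; last exact: measurableI.
have [P0|P0] := eqVneq (Prob (X s) (mode_is k j)) 0%E.
  suff -> : Prob (X s) (G `&` mode_is k j) = 0%E by rewrite mule0 mul0e.
  by apply: (subset_measure0 _ _ _ P0) => //; exact: measurableI.
rewrite muleC; congr (_ * _)%E.
have := homog s j k 0%N j i u B u0 mB P0.
rewrite mode0 probability_setT => /(_ (oner_neq0 _)).
rewrite /cond_prob probability_setT setIT divr1 setIC -cM => cE.
have PM : Prob (X s) (mode_is k j) = (fine (Prob (X s) (mode_is k j)))%:E.
  by rewrite fineK // fin_num_measure.
rewrite -[RHS]fineK ?fin_num_measure //; last exact: measurable_transition.
rewrite -cE PM -EFinM /= mulfK //.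
by apply: contraNneq P0 => P0; rewrite PM P0.
Qed.

(** Both sides are finite measures in [E]; they agree on the products of a ray and a
    Borel set by [history_transition]. *)
Lemma history_factor s k G j i (E : set (R * borel_mat R n n)) :
  sigma_history (X s) k G -> measurable E ->
  (Prob (X s) (G `&` ((fun w => (holding k w, reset k w)) @^-1` E) `&`
       (mode_is k j `&` mode_is k.+1 i)) =
   Prob (X s) (G `&` mode_is k j) *
   Prob (X j) ((fun w => (holding 0 w, reset 0 w)) @^-1` E `&` mode_is 1 i))%E.
Proof.
move=> hG; pose q (Z : switching R N n) k (w : Omega Z) : R * borel_mat R n n :=
  (holding k w, reset k w).
have mq Z l : measurable_fun setT (q Z l) by exact: measurable_holding_reset.
have mG := history_measurable hG; have mM := measurable_mode_is (X s) k j.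
have mD1 : measurable (G `&` (mode_is k j `&` mode_is k.+1 i)).
  by do ?apply: measurableI => //; exact: measurable_mode.
have c_fin : Prob (X s) (G `&` mode_is k j) \is a fin_num.
  by rewrite fin_num_measure //; exact: measurableI.
pose c : {nonneg R} := NngNum (fine_ge0 (measure_ge0 (Prob (X s)) (G `&` mode_is k j))).
pose m1 : {measure set (R * borel_mat R n n)%type -> \bar R} :=
  law_on (Prob (X s)) mD1 (mq _ k).
pose m2 : {measure set (R * borel_mat R n n)%type -> \bar R} :=
  mscale c (law_on (Prob (X j)) (measurable_mode_is (X j) 1 i) (mq _ 0%N)).
move=> mE; have : m1 E = m2 E.
  apply: (measure_unique
    [set E | exists (u : R) (B : set (borel_mat R n n)), measurable B /\ E = [set x | x <= u] `*` B]
    (fun p => [set x | x <= p%:R] `*` setT)) => //.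
  - exact: prod_ray_measurable.
  - move=> _ _ [u [B [mB ->]]] [v [C [mC ->]]]; exists (Num.min u v), (B `&` C).
    split; first exact: measurableI.
    by apply/seteqP; split=> -[x M] /=; rewrite le_min; [case=> -[-> ?] [-> ?]|case=> /andP[-> ->] []].
  - by move=> p; exists p%:R, setT.
  - apply/seteqP; split=> // -[x M] _; exists (Num.bound `|x|) => //=; split=> //.
    by apply: (le_trans (ler_norm x)); apply: ltW; apply: archi_boundP.
  - move=> _ [u [B [mB ->]]].
    have := history_transition j i u hG mB.
    rewrite -{1}(fineK c_fin) => H.
    transitivity (Prob (X s) (G `&` mode_is k j `&` transition k i u B)).
      rewrite -[m1 _]/(Prob (X s) (q _ k @^-1` _ `&` _)); congr (Prob (X s) _).
      apply/seteqP; split=> w /=.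
        by case=> -[? ?] [? [? ?]].
      by case=> -[? ?] [? ? ?].
    rewrite H -[m2 _]/(_ * Prob (X j) (q _ 0%N @^-1` _ `&` mode_is 1 i))%E.
    congr (_ * Prob (X j) _)%E; apply/seteqP; split=> w /=; first by case.
    by case=> -[? ?] ?.
  - move=> p; rewrite ltey_eq; apply/orP; left.
    rewrite -[m1 _]/(Prob (X s) (q _ k @^-1` _ `&` _)) fin_num_measure //.
    have mray : measurable ([set x : R | x <= p%:R] `*` [set: borel_mat R n n]).
      by apply: measurableX => //; rewrite -set_itvNyc.
    by apply: measurableI => //; rewrite -[_ @^-1` _]setTI; exact: (mq (X s) k measurableT _ mray).
rewrite -[m2 _]/((fine (Prob (X s) (G `&` mode_is k j)))%:E *
  Prob (X j) (q _ 0%N @^-1` E `&` mode_is 1 i))%E fineK // => <-.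
rewrite -[m1 _]/(Prob (X s) (q _ k @^-1` E `&` (G `&` (mode_is k j `&` mode_is k.+1 i)))).
by congr (Prob (X s) _); rewrite [RHS]setIA; congr (_ `&` _); rewrite setIC.
Qed.

(** Given [sigma_k = j], the step [k] is independent of the past and has the law of
    the first step from mode [j]; this passes from events to functions by Tonelli. *)
Lemma semi_markov_integral s k j i (g : Omega (X s) -> R) (phi : R * borel_mat R n n -> R) :
  (forall A, measurable A -> sigma_history (X s) k (g @^-1` A)) ->
  (forall w, 0 <= g w) -> measurable_fun [set: R * borel_mat R n n] phi -> (forall y, 0 <= phi y) ->
  (\int[Prob (X s)]_(w in mode_is k j `&` mode_is k.+1 i) (g w * phi (holding k w, reset k w))%:E =
   \int[Prob (X s)]_(w in mode_is k j) (g w)%:E *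
   \int[Prob (X j)]_(w in mode_is 1 i) (phi (holding 0 w, reset 0 w))%:E)%E.
Proof.
move=> hg g0 mphi phi0.
have mq (Z : switching R N n) l := @measurable_holding_reset Z l.
apply: (@ge0_integral_factor _ _ _ _ _ (R * borel_mat R n n)%type R (Prob (X s)) (Prob (X j))
  _ _ _ g (fun w => (holding k w, reset k w)) (fun w => (holding 0 w, reset 0 w)) phi) => //.
- by apply: measurableI; exact: measurable_mode.
- exact: measurable_mode.
- exact: measurable_mode.
- by move=> _ A mA; rewrite setTI; exact: history_measurable (hg A mA).
- by move=> A B mA mB; rewrite history_factor //; exact: hg.
Qed.

End SemiMarkov.

(** * Solutions of the switched equation *)

Section Flow.
Context (R : realType).

Lemma dnbhs_shift (u : R) : h + u @[h --> 0^'] --> u^'.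
Proof.
move=> P /= uP; have : h + u @[h --> (0 : R)] --> u.
  rewrite -[X in _ --> X]add0r; apply: cvgD; [exact: cvg_id|exact: cvg_cst].
move=> H; have Q : \forall h \near (0 : R), h + u != u -> P (h + u) by exact: H _ uP.
rewrite /= nbhs_simpl /= near_simpl near_withinE; apply: filterS Q => h /= Ph h0; apply: Ph.
by rewrite -subr_eq0 addrK.
Qed.

Lemma dnbhs_unshift (u : R) : v - u @[v --> u^'] --> 0^'.
Proof.
move=> P /= uP; have : v - u @[v --> u] --> (0 : R).
  rewrite -[X in _ --> X](subrr u); apply: cvgB; [exact: cvg_id|exact: cvg_cst].
move=> H; have Q : \forall v \near u, v - u != 0 -> P (v - u) by exact: H _ uP.
rewrite /= nbhs_simpl /= near_simpl near_withinE; apply: filterS Q => v /= Pv vu; apply: Pv.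
by rewrite subr_eq0.
Qed.

Lemma is_derive_quotient (f : R -> R) (u d : R) :
  (v - u)^-1 * (f v - f u) @[v --> u^'] --> d <-> is_derive u (1 : R) f d.
Proof.
split=> [fd|[der <-]].
  have H : h^-1 *: (f (h *: (1 : R) + u) - f u) @[h --> 0^'] --> d.
    have := cvg_comp _ _ (@dnbhs_shift u) fd; apply: cvg_trans.
    apply: near_eq_cvg; apply: nearW => h /=.
    by rewrite addrK /GRing.scale /= mulr1.
  split; first by apply/cvg_ex; exists d.
  exact: (cvg_lim _ H).
have H : h^-1 *: (f (h *: (1 : R) + u) - f u) @[h --> 0^'] --> 'D_1 f u by exact: der.
have := cvg_comp _ _ (@dnbhs_unshift u) H; apply: cvg_trans.
apply: near_eq_cvg; apply: nearW => h /=.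
by rewrite /GRing.scale /= mulr1 subrK.
Qed.

Context (N n : nat) (A : 'I_N -> 'M[R]_n).
Implicit Types (sigma : nat -> 'I_N) (t : nat -> R) (J : nat -> 'M[R]_n).

Fixpoint flow sigma t J (k : nat) : 'M[R]_n :=
  if k is k'.+1
  then J k' *m expmx ((t k'.+1 - t k') *: A (sigma k')) *m flow sigma t J k'
  else 1%:M.

Section Path.
Variables (sigma : nat -> 'I_N) (t : nat -> R) (J : nat -> 'M[R]_n) (x0 : 'cV[R]_n).
Hypothesis t_nondec : forall k, t k <= t k.+1.

Local Notation state k := (flow sigma t J k *m x0).

Lemma time_mono k l : (k <= l)%N -> t k <= t l.
Proof.
elim: l => [|l IHl]; first by rewrite leqn0 => /eqP ->.
rewrite leq_eqVlt => /predU1P[-> //|]; rewrite ltnS => /IHl kl.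
exact: le_trans kl (t_nondec l).
Qed.

Lemma interval_unique k l u : t k <= u < t k.+1 -> t l <= u < t l.+1 -> k = l.
Proof.
move=> /andP[ku uk] /andP[lu ul]; case: (ltngtP k l) => // /time_mono kl.
  by have := lt_le_trans uk (le_trans kl lu); rewrite ltxx.
by have := lt_le_trans ul (le_trans kl ku); rewrite ltxx.
Qed.

(** The equation says nothing from [sup t_k] on, if finite; the value there is set to 0. *)
Definition flow_path (u : R) : 'cV[R]_n :=
  if pselect (exists k, t k <= u < t k.+1) is left H
  then let k := projT1 (cid H) in expmx ((u - t k) *: A (sigma k)) *m state k
  else 0.

Lemma flow_pathE k u : t k <= u < t k.+1 ->
  flow_path u = expmx ((u - t k) *: A (sigma k)) *m state k.
Proof.
move=> ku; rewrite /flow_path; case: pselect => [H|[]]; last by exists k.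
by case: cid => l /= lu; rewrite (interval_unique ku lu).
Qed.

End Path.

Section Trajectory.
Variables (sigma : nat -> 'I_N) (t : nat -> R) (J : nat -> 'M[R]_n) (x0 : 'cV[R]_n).
Hypotheses (t0 : t 0%N = 0) (t_incr : forall k, t k < t k.+1).

Local Notation state k := (flow sigma t J k *m x0).

(** A solution is unique on each interval between switches; by continuity of the
    exponential, its left limit at [t_(k+1)] is the value there of the same formula. *)
Lemma trajectory_flow x : trajectory A sigma t J x0 x ->
  forall k u, t k <= u < t k.+1 ->
    x u = expmx ((u - t k) *: A (sigma k)) *m state k.
Proof.
move=> [x00 xder xjump].
have segment k u : t k <= u < t k.+1 ->
    x u = expmx ((u - t k) *: A (sigma k)) *m x (t k).
  apply: linear_ode_unique => [{}u /andP[ku uk] i j|i j].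
    apply/is_derive_quotient.
    have := xder k u; rewrite ltW //= uk => /(_ isT) H.
    have {}H := cvg_coord (i := i) (j := j) (FF := within_filter _ (dnbhs_filter u)) H.
    move: H; under eq_cvg do rewrite !mxE; apply: cvg_trans; apply: cvg_app.
    move=> P kP.
    have {}kP : \forall v \near u, v != u -> `[t k, t k.+1[%classic v -> P v by exact: kP.
    suff : \forall v \near u, v != u -> P v by [].
    have : \forall v \near u, v \in `]t k, t k.+1[ by apply: near_in_itvoo; rewrite in_itv /= ku.
    move: kP; apply: filterS2 => v Pv; rewrite in_itv /= => /andP[kv vk] vu.
    by apply: Pv => //; rewrite /= in_itv /= ltW.
  have := xder k (t k); rewrite lexx t_incr => /(_ isT) H.
  have {}H := cvg_coord (i := i) (j := j) (FF := within_filter _ (dnbhs_filter (t k))) H.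
  have {}H : (v - t k)^-1 * (x v i j - x (t k) i j) @[v --> (t k)^'+] --> (A (sigma k) *m x (t k)) i j.
    move: H; under eq_cvg do rewrite !mxE; apply: cvg_trans; apply: cvg_app.
    move=> P kP.
    have {}kP : \forall v \near t k, v != t k -> `[t k, t k.+1[%classic v -> P v by exact: kP.
    suff : \forall v \near t k, t k < v -> P v by [].
    have : \forall v \near t k, v < t k.+1 by exact: lt_nbhsl (t_incr k).
    move: kP; apply: filterS2 => v Pv vk kv.
    by apply: Pv; [rewrite gt_eqF|rewrite /= in_itv /= ltW].
  have D0 : v - t k @[v --> (t k)^'+] --> (0 : R).
    rewrite -[X in _ --> X](subrr (t k)).
    apply: (@cvg_at_right_filter _ _ (fun v => v - t k)); apply: cvgB; [exact: cvg_id|exact: cvg_cst].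
  have H1 : (v - t k) * ((v - t k)^-1 * (x v i j - x (t k) i j)) + x (t k) i j
      @[v --> (t k)^'+] --> x (t k) i j.
    rewrite -[X in _ --> X]add0r -[X in _ --> X + _](mul0r ((A (sigma k) *m x (t k)) i j)).
    by apply: cvgD; [exact: cvgM|exact: cvg_cst].
  move: H1; apply: cvg_trans; apply: near_eq_cvg; near=> v.
  rewrite mulrA divff ?mul1r ?subrK // subr_eq0 gt_eqF //.
have start k : x (t k) = state k.
  elim: k => [|k IHk]; first by rewrite t0 x00 mul1mx.
  have [y xy ->] := xjump k.
  suff -> : y = expmx ((t k.+1 - t k) *: A (sigma k)) *m x (t k).
    by rewrite IHk /= !mulmxA.
  apply: (cvg_unique _ xy); first exact: norm_hausdorff.
  apply: cvg_mx => i j.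
  have lim : (expmx ((v - t k) *: A (sigma k)) *m x (t k)) i j @[v --> (t k.+1)^'-] -->
      (expmx ((t k.+1 - t k) *: A (sigma k)) *m x (t k)) i j.
    rewrite mxE; under eq_cvg do rewrite mxE.
    apply: cvg_big => [|c _]; first exact: add_continuous.
    apply: cvgM; last exact: cvg_cst.
    apply: (@cvg_at_left_filter _ _ (fun v => expmx ((v - t k) *: A (sigma k)) i c)).
    apply: (@continuous_comp _ _ _ (fun v => v - t k) (fun s => expmx (s *: A (sigma k)) i c)).
      by apply: cvgB; [exact: cvg_id|exact: cvg_cst].
    exact: expmx_continuous.
  move: lim; apply: cvg_trans; apply: near_eq_cvg; near=> v.
  rewrite -(segment k v) //; apply/andP; split.
    by apply: ltW; near: v; exact: nbhs_left_gt.
  by near: v; exact: nbhs_left_lt.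
by move=> k u ku; rewrite (segment k u) // start.
Unshelve. all: by end_near. Qed.

Let expmx_shift_der k (y : 'cV[R]_n) (u : R) i :
  is_derive u (1 : R) (fun v => (expmx ((v - t k) *: A (sigma k)) *m y) i 0)
    ((A (sigma k) *m (expmx ((u - t k) *: A (sigma k)) *m y)) i 0).
Proof.
under eq_fun do rewrite mxE.
have dE a b : is_derive u (1 : R) (fun v => expmx ((v - t k) *: A (sigma k)) a b)
    ((A (sigma k) *m expmx ((u - t k) *: A (sigma k))) a b).
  have H := @is_derive1_comp _ (fun s => expmx (s *: A (sigma k)) a b) (fun v => v - t k) u _ _
    (expmx_is_derive (A (sigma k)) a b (u - t k)) (is_derive_shift u 1 (- t k)).
  by apply: (is_derive_eq H); rewrite mulr1.
apply: is_derive_eq.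
  by apply: is_derive_sum_fct => c; exact: is_derive_mul (dE i c) (is_derive_cst (y c 0) u 1).
rewrite mulmxA [RHS]mxE; apply: eq_bigr => c _.
by rewrite scaler0 add0r -[LHS]/(y c 0 * _) mulrC.
Qed.

Lemma flow_path_trajectory : trajectory A sigma t J x0 (flow_path sigma t J x0).
Proof.
have flow_pathE' := flow_pathE sigma J x0 (fun k => ltW (t_incr k)).
split.
- rewrite (flow_pathE' 0%N) ?t0 ?lexx -?t0 ?t_incr //.
  by rewrite subrr expmx0 /= !mul1mx.
- move=> k u ku; apply: cvg_mx => i j; rewrite (ord1 j) (flow_pathE' _ _ ku).
  have /is_derive_quotient H := expmx_shift_der k (state k) u i.
  have {}H := cvg_trans (cvg_fmap2 (@cvg_within _ (u^') (dnbhs_filter u) `[t k, t k.+1[%classic)) H.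
  move: H; apply: cvg_trans; apply: near_eq_cvg.
  apply: filterS (@withinT _ (u^') `[t k, t k.+1[%classic _) => v /=; rewrite in_itv /= => kv.
  by rewrite (flow_pathE' _ _ kv) !mxE.
move=> k; exists (expmx ((t k.+1 - t k) *: A (sigma k)) *m state k).
  apply: cvg_mx => i j; rewrite (ord1 j).
  have [der _] := expmx_shift_der k (state k) (t k.+1) i.
  have lim := @cvg_at_left_filter _ _ _ _ _ (differentiable_continuous (iffLR (derivable1_diffP _ _) der)).
  move: lim; apply: cvg_trans; apply: near_eq_cvg; near=> v.
  rewrite -(flow_pathE' k v) //; apply/andP; split.
    by apply: ltW; near: v; exact: nbhs_left_gt.
  by near: v; exact: nbhs_left_lt.
rewrite (flow_pathE' k.+1) ?lexx ?t_incr // subrr expmx0 mul1mx /=.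
by rewrite !mulmxA.
Unshelve. all: by end_near. Qed.

End Trajectory.
End Flow.

(** * Measurability of functions of the switching process *)

Section MeasurableMatrices.
Context (R : realType).

(** Measurability for the Borel sets of matrices, expressed on the entries; see
    [measurable_borel_mx]. *)
Definition mx_measurable d (S : measurableType d) p q (M : S -> 'M[R]_(p, q)) : Prop :=
  forall i j, measurable_fun [set: S] (fun w => M w i j).

Section Entries.
Context d (S : measurableType d).

Lemma mx_measurable_mul p q r (M : S -> 'M[R]_(p, q)) (M' : S -> 'M[R]_(q, r)) :
  mx_measurable M -> mx_measurable M' -> mx_measurable (fun w => M w *m M' w).
Proof.
move=> mM mM' i j; rewrite (_ : (fun w => _) = fun w => \sum_k M w i k * M' w k j).
  by apply: measurable_sum => k; exact: measurable_funM.
by apply/funext => w; rewrite mxE.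
Qed.

Lemma mx_measurable_cst p q (M : 'M[R]_(p, q)) : mx_measurable (fun _ : S => M).
Proof. by move=> i j; exact: measurable_cst. Qed.

Lemma mx_measurable_abs p q (M : S -> 'M[R]_(p, q)) :
  mx_measurable M -> mx_measurable (fun w => map_mx Num.norm (M w)).
Proof.
move=> mM i j; rewrite (_ : (fun w => _) = fun w => `|M w i j|).
  by apply: measurableT_comp => //; exact: mM.
by apply/funext => w; rewrite mxE.
Qed.

Lemma mx_measurable_lift n m (M : S -> 'M[R]_n) :
  mx_measurable M -> mx_measurable (fun w => lift_mx m (M w)).
Proof.
move=> mM a b; rewrite (_ : (fun w => _) = fun w =>
    \sum_(v : word n m) (if word_expo v == b then mono_coef R a / mono_coef R b *
       \prod_t M w (expo_word a t) (v t) else 0)).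
  apply: measurable_sum => v; case: (_ == b); last exact: measurable_cst.
  by apply: measurable_funM; [exact: measurable_cst|apply: measurable_prod => t _; exact: mM].
by apply/funext => w; rewrite lift_mxE mxE big_mkcond.
Qed.

Lemma mx_measurable_expmx N n (A : 'I_N -> 'M[R]_n) (sg : S -> 'I_N) (h : S -> R) :
  (forall i, measurable (sg @^-1` [set i])) -> measurable_fun [set: S] h ->
  mx_measurable (fun w => expmx (h w *: A (sg w))).
Proof.
move=> msg mh a b; rewrite (_ : (fun w => _) = fun w =>
    \sum_i \1_(sg @^-1` [set i]) w * expmx (h w *: A i) a b).
  apply: measurable_sum => i; apply: measurable_funM; first exact: measurable_indic.
  have mE : measurable_fun [set: R] (fun t => expmx (t *: A i) a b).
    by apply: continuous_measurable_fun; exact: expmx_continuous.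
  exact: (measurableT_comp mE mh).
apply/funext => w; rewrite (bigD1 (sg w)) //= big1 => [|i iw].
  by rewrite indicE mem_set // mul1r addr0.
by rewrite indicE memNset ?mul0r // => wi; rewrite -wi eqxx in iw.
Qed.

Lemma mx_measurable_flow N n (A : 'I_N -> 'M[R]_n) (sg : nat -> S -> 'I_N)
    (tm : nat -> S -> R) (J : nat -> S -> 'M[R]_n) k :
  (forall l i, (l < k)%N -> measurable (sg l @^-1` [set i])) ->
  (forall l, (l <= k)%N -> measurable_fun [set: S] (tm l)) ->
  (forall l, (l < k)%N -> mx_measurable (J l)) ->
  mx_measurable (fun w => flow A (sg^~ w) (tm^~ w) (J^~ w) k).
Proof.
elim: k => [|k IHk] msg mtm mJ; first exact: mx_measurable_cst.
apply: mx_measurable_mul.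
  apply: mx_measurable_mul; first exact: mJ.
  apply: mx_measurable_expmx => [i|]; first exact: msg.
  by apply: measurable_funB; exact: mtm.
by apply: IHk => *; [apply: msg|apply: mtm|apply: mJ]; rewrite ltnW.
Qed.

Lemma measurable_mx_ball p q (M : S -> 'M[R]_(p, q)) (c : 'M[R]_(p, q)) r :
  mx_measurable M -> measurable (M @^-1` ball c r).
Proof.
move=> mM; have [r0|r0] := ltP 0 r; last first.
  rewrite (_ : _ @^-1` _ = set0) //; apply/seteqP; split=> // w [r0'].
  by move: r0; rewrite leNgt r0'.
rewrite (_ : _ @^-1` _ = \big[setI/setT]_i \big[setI/setT]_j
    ((fun w => M w i j) @^-1` ball (c i j) r)).
  apply: bigsetI_measurable => i _; apply: bigsetI_measurable => j _.
  by rewrite -[_ @^-1` _]setTI; apply: mM => //; apply: open_measurable; exact: ball_open.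
apply/seteqP; split=> w.
  by move=> [_ Mw]; elim/big_ind: _ => // i _; elim/big_ind: _ => // j _; exact: Mw.
move=> Mw; split=> // i j; move: Mw.
by rewrite (bigD1 i) //= => -[+ _]; rewrite (bigD1 j) //= => -[].
Qed.

(** Every open set of matrices is a countable union of balls with rational centre
    and radius. *)
Lemma measurable_borel_mx p q (M : S -> 'M[R]_(p, q)) :
  mx_measurable M -> forall B, borel_mx B -> measurable (M @^-1` B).
Proof.
move=> mM B mB.
suff H : measurable_fun [set: S] (M : S -> borel_mat R p q).
  by rewrite -[_ @^-1` _]setTI; exact: H.
apply: (@measurability _ _ S (borel_mat R p q) setT M
  [set U : set 'M[R]_(p, q) | open U] erefl) => _ [U /= oU <-].
rewrite setTI; pose Mr (c : 'M[rat]_(p, q)) : 'M[R]_(p, q) := map_mx ratr c.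
pose good (cr : 'M[rat]_(p, q) * rat) := ball (Mr cr.1) (ratr cr.2) `<=` U.
rewrite (_ : M @^-1` U = \bigcup_(cr in good) (M @^-1` ball (Mr cr.1) (ratr cr.2))).
  rewrite bigcup_mkcond; apply: countable_bigcupT_measurable => [|cr].
    exact: countableP.
  by case: ifP => // _; exact: measurable_mx_ball.
apply/seteqP; split=> w; last by move=> [cr cU /cU].
move=> /= UMw; have /nbhs_ballP[e /= e0 eU] := open_nbhs_nbhs (conj oU UMw).
have [r re] : exists r : rat, ratr r \in `]0, e / 2[ by apply: rat_in_itvoo; rewrite divr_gt0.
move: re; rewrite in_itv /= => /andP[r0 re].
have close i j : exists c : rat, ratr c \in `]M w i j - ratr r, M w i j + ratr r[.
  by apply: rat_in_itvoo; rewrite ltrBlDr -addrA ltrDl addr_gt0.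
pose c : 'M[rat]_(p, q) := \matrix_(i, j) projT1 (cid (close i j)).
have cM : ball (Mr c) (ratr r) (M w).
  split=> // i j; rewrite !mxE; case: cid => z /=; rewrite in_itv /= => zM.
  by rewrite /ball /= ltr_distl.
exists (c, r) => //= M' cM'; apply: eU.
apply: (ball_split (z := Mr c)).
  by apply: le_ball (ball_sym cM); exact: ltW.
by apply: le_ball cM'; exact: ltW.
Qed.

End Entries.

Lemma borel_mat_continuous p q (f : 'M[R]_(p, q) -> R) : continuous f ->
  measurable_fun [set: borel_mat R p q] (f : borel_mat R p q -> R).
Proof.
move=> cf; apply: (measurability _ (RGenOpens.measurableE R)) => _ [_ [a [b ->]] <-].
rewrite setTI; apply: sub_sigma_algebra.
by move/continuousP : cf; apply; exact: interval_open.
Qed.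

Lemma borel_mat_norm p q :
  measurable_fun [set: borel_mat R p q] (fun M : borel_mat R p q => `|M : 'M[R]_(p, q)|).
Proof. by apply: borel_mat_continuous; exact: norm_continuous. Qed.

Lemma borel_mat_coord p q : mx_measurable (fun M : borel_mat R p q => (M : 'M[R]_(p, q))).
Proof. by move=> i j; apply: borel_mat_continuous; exact: coord_continuous. Qed.

Lemma mx_measurable_norm d (S : measurableType d) p q (M : S -> 'M[R]_(p, q)) :
  mx_measurable M -> measurable_fun [set: S] (fun w => `|M w|).
Proof.
move=> mM; have mM' : measurable_fun [set: S] (M : S -> borel_mat R p q).
  by move=> _ B mB; rewrite setTI; exact: (measurable_borel_mx mM).
exact: (measurableT_comp (@borel_mat_norm p q) mM').
Qed.

End MeasurableMatrices.

(** * Moments of the state at the switching times *)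

Section IntegralModes.
Context (R : realType) (N n : nat) (Z : switching R N n).

Lemma integral_modes k (D : set (Omega Z)) (f : Omega Z -> \bar R) :
  measurable D -> measurable_fun D f -> (forall w, D w -> 0 <= f w)%E ->
  (\int[Prob Z]_(w in D) f w = \sum_i \int[Prob Z]_(w in D `&` mode_is k i) f w)%E.
Proof.
move=> mD mf f0.
have DE : D = \big[setU/set0]_(i <- index_enum 'I_N) (D `&` mode_is k i).
  apply/seteqP; split=> w.
    by move=> Dw; rewrite (bigD1 (mode k w)) //=; left.
  by elim/big_ind: _ => // [U V HU HV [/HU|/HV] //|i _ []].
have mode_trivI : trivIset [set` index_enum 'I_N] (fun i => D `&` @mode_is _ _ _ Z k i).
  by move=> i j _ _ [w [[_ wi] [_ wj]]]; rewrite -wi -wj.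
have mDi i : measurable (D `&` @mode_is _ _ _ Z k i).
  by apply: measurableI => //; exact: measurable_mode.
have := @ge0_integral_bigsetU _ _ _ (Prob Z) _ (fun i => D `&` mode_is k i) f
  (index_enum 'I_N) mDi (index_enum_uniq _) mode_trivI.
by rewrite -DE => ->.
Qed.

End IntegralModes.

Section History.
Context (R : realType) (N n : nat) (Z : switching R N n).

Lemma history_preimage k (g : Omega Z -> R) :
  measurable_fun [set: history_space Z k] (g : history_space Z k -> R) ->
  forall A, measurable A -> sigma_history Z k (g @^-1` A).
Proof.
move=> mg A mA; have H := mg measurableT A mA; rewrite setTI in H; exact: H.
Qed.

Lemma history_measurable_fun k (g : Omega Z -> R) :
  measurable_fun [set: history_space Z k] (g : history_space Z k -> R) ->
  measurable_fun [set: Omega Z] g.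
Proof.
by move=> mg _ A mA; rewrite setTI; exact: history_measurable (history_preimage mg mA).
Qed.

Lemma history_mode_measurable k l i : (l <= k)%N ->
  measurable (mode l @^-1` [set i] : set (history_space Z k)).
Proof. by move=> lk; apply: sub_sigma_algebra; apply: Or31; exists l, i. Qed.

Lemma history_time_measurable k l : (l <= k)%N ->
  measurable_fun [set: history_space Z k] (time l : history_space Z k -> R).
Proof.
by move=> lk _ Y mY; rewrite setTI; apply: sub_sigma_algebra; apply: Or32; exists l, Y.
Qed.

Lemma history_reset_measurable k l : (l < k)%N ->
  mx_measurable (reset l : history_space Z k -> 'M[R]_n).
Proof.
move=> lk i j; apply: (measurableT_comp (borel_mat_coord i j)).
by move=> _ B mB; rewrite setTI; apply: sub_sigma_algebra; apply: Or33; exists l, B.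
Qed.

End History.

Section Cocycle.
Context (R : realType) (N n : nat) (A : 'I_N -> 'M[R]_n).

Definition absmx p q (M : 'M[R]_(p, q)) : 'M[R]_(p, q) := map_mx Num.norm M.

Lemma absmx_id p (M : 'M[R]_p) : nonneg_mx M -> absmx M = M.
Proof. by move=> M0; apply/matrixP => i j; rewrite mxE ger0_norm. Qed.

Definition step_mx (j : 'I_N) (y : R * borel_mat R n n) : 'M[R]_n :=
  absmx (y.2 : 'M[R]_n) *m expmx (y.1 *: A j).

(** The resets are made nonnegative everywhere, so that no null set has to be set
    aside; for a positive system this changes them on a null set only. *)
Definition cocycle (Z : switching R N n) k (w : Omega Z) : 'M[R]_n :=
  flow A (fun l => mode l w) (fun l => time l w) (fun l => absmx (reset l w)) k.

Lemma cocycleS (Z : switching R N n) k (w : Omega Z) :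
  cocycle k.+1 w = step_mx (mode k w) (holding k w, reset k w) *m cocycle k w.
Proof. by []. Qed.

Lemma mx_measurable_step j : mx_measurable (step_mx j).
Proof.
apply: mx_measurable_mul.
  apply: mx_measurable_abs => a b; apply: (measurableT_comp (borel_mat_coord a b)).
  exact: measurable_snd.
apply: (mx_measurable_expmx (sg := fun=> j) A) => [i|]; last exact: measurable_fst.
by rewrite preimage_cst; case: ifP.
Qed.

Lemma cocycle_history_measurable (Z : switching R N n) k :
  mx_measurable (@cocycle Z k : history_space Z k -> 'M[R]_n).
Proof.
apply: mx_measurable_flow => [l i /ltnW|l|l lk].
- exact: history_mode_measurable.
- exact: history_time_measurable.
- by apply: mx_measurable_abs; exact: history_reset_measurable.
Qed.

Lemma lift_cocycle_history_measurable (Z : switching R N n) k m a b :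
  measurable_fun [set: history_space Z k]
    ((fun w : Omega Z => lift_mx m (cocycle k w) a b) : history_space Z k -> R).
Proof.
apply: (@mx_measurable_lift _ _ (history_space Z k) n m (@cocycle Z k)).
exact: cocycle_history_measurable.
Qed.

Hypothesis metzA : forall i, metzler (A i).

Lemma nonneg_mx_mul p (M M' : 'M[R]_p) : nonneg_mx M -> nonneg_mx M' -> nonneg_mx (M *m M').
Proof. by move=> M0 M0' i j; rewrite mxE sumr_ge0 // => l _; rewrite mulr_ge0. Qed.

Lemma step_mx_ge0 j y : 0 <= y.1 -> nonneg_mx (step_mx j y).
Proof.
move=> y0; apply: nonneg_mx_mul; last exact: expmx_metzler_ge0.
by move=> a b; rewrite mxE.
Qed.

Lemma cocycle_ge0 (Z : switching R N n) k (w : Omega Z) : nonneg_mx (cocycle k w).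
Proof.
elim: k => [|k IHk]; first by move=> a b; rewrite mxE; case: (a == b).
by rewrite cocycleS; apply: nonneg_mx_mul => //; apply: step_mx_ge0; exact: holding_ge0.
Qed.

End Cocycle.

Lemma lift_mx_bounded (R : realType) n m (c : R) : exists2 B, 0 <= B &
  forall M : 'M[R]_n, (forall i j, `|M i j| <= c) -> forall a b, `|lift_mx m M a b| <= B.
Proof.
pose b0 (a b : 'I_(lift_dim n m)) : R := \sum_(w : word n m | word_expo w == b)
  mono_coef R a / mono_coef R b * `|c| ^+ m.
have mc0 a : 0 <= mono_coef R (a : 'I_(lift_dim n m)) by exact: ltW (mono_coef_gt0 _ _).
have b00 a b : 0 <= b0 a b.
  by rewrite sumr_ge0 // => w _; rewrite mulr_ge0 ?divr_ge0 // exprn_ge0.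
exists (\sum_a \sum_b b0 a b); first by rewrite sumr_ge0 // => a _; rewrite sumr_ge0.
move=> M Mc a b; apply: (@le_trans _ _ (b0 a b)).
  rewrite lift_mxE mxE; apply: (le_trans (ler_norm_sum _ _ _)); apply: ler_sum => w _.
  rewrite normrM ger0_norm ?divr_ge0 //; apply: ler_wpM2l; first by rewrite divr_ge0.
  rewrite normr_prod; apply: (@le_trans _ _ (\prod_(t < m) `|c|)).
    by apply: ler_prod => t _; rewrite normr_ge0 (le_trans (Mc _ _)) // ler_norm.
  by rewrite prodr_const card_ord.
rewrite (bigD1 a) //= (bigD1 b) //= -addrA lerDl addr_ge0 ?sumr_ge0 //.
by move=> a' _; rewrite sumr_ge0.
Qed.

Section Moments.
Context (R : realType) (N n m : nat) (A : 'I_N -> 'M[R]_n) (X : 'I_N -> switching R N n).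
Variables (T K : R).
Hypotheses (smX : semi_markovian X) (posX : positive_system A X).
Hypothesis hX : forall s k, {ae Prob (X s), forall w, 0 < holding k w <= T}.
Hypothesis JX : forall s k, {ae Prob (X s), forall w, `|reset k w| <= K}.

Local Notation TM := (transition_mx A m X).

Definition regular s (w : Omega (X s)) : Prop :=
  forall k, [/\ 0 < holding k w <= T, `|reset k w| <= K & nonneg_mx (reset k w)].

Lemma ae_regular s : {ae Prob (X s), forall w, regular w}.
Proof.
apply/ae_foralln => k.
apply: filterS3 (hX s k) (JX s k) (posX.2 s k) => w h J J0; by split.
Qed.

Lemma expmx_bounded_modes : exists2 C, 0 < C &
  forall i t a b, `|t| <= T -> `|expmx (t *: A i) a b| <= C.
Proof.
pose C i := s2val (cid2 (expmx_bounded (A i) T)).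
have C0 i : 0 < C i by rewrite /C; case: cid2.
exists (1 + \sum_i C i); first by rewrite ltr_pwDl // sumr_ge0 // => i _; exact: ltW.
move=> i t a b tT; apply: (@le_trans _ _ (C i)).
  by rewrite /C; case: cid2 => /= c _; apply.
by rewrite (bigD1 i) //= addrCA lerDl addr_ge0 // sumr_ge0 // => l _; exact: ltW.
Qed.

Lemma lift_step_bounded : exists2 B, 0 <= B &
  forall s (w : Omega (X s)), regular w -> forall j a b,
    `|lift_mx m (step_mx A j (holding 0 w, reset 0 w)) a b| <= B.
Proof.
have [C C0 HC] := expmx_bounded_modes.
have [B B0 HB] := lift_mx_bounded n m (\sum_(l < n) (K * C)).
exists B => // s w rw j a b; apply: HB => i l.
rewrite mxE; apply: (le_trans (ler_norm_sum _ _ _)); apply: ler_sum => c _.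
have [/andP[h0 hT] JK _] := rw 0%N.
rewrite normrM; apply: ler_pM => //.
  by rewrite mxE normr_id; apply: le_trans JK; exact: coord_le_norm.
by apply: HC; rewrite /= ger0_norm // ltW.
Qed.

Definition block_mean (j i : 'I_N) a b : \bar R :=
  (\int[Prob (X j)]_(w in mode_is 1 i)
     (lift_mx m (step_mx A j (holding 0 w, reset 0 w)) a b)%:E)%E.

Lemma measurable_lift_step s k j a b : measurable_fun [set: Omega (X s)]
  (fun w => lift_mx m (step_mx A j (holding k w, reset k w)) a b).
Proof.
have mq := @measurable_holding_reset R N n (X s) k.
have mf : measurable_fun [set: R * borel_mat R n n] (fun y => lift_mx m (step_mx A j y) a b).
  exact: (mx_measurable_lift (mx_measurable_step A j)).
exact: (measurableT_comp mf mq).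
Qed.

Lemma lift_step_ge0 s (w : Omega (X s)) k j a b :
  0 <= lift_mx m (step_mx A j (holding k w, reset k w)) a b.
Proof. by apply: lift_mx_ge0; apply: step_mx_ge0; [exact: posX.1|exact: holding_ge0]. Qed.

Lemma block_mean_le : exists2 B, 0 <= B &
  forall j i a b, (block_mean j i a b <= B%:E * Prob (X j) (mode_is 1 i))%E.
Proof.
have [B B0 HB] := lift_step_bounded; exists B => // j i a b.
have mM : measurable (@mode_is _ _ _ (X j) 1 i) by exact: measurable_mode.
rewrite -integral_cst //; apply: ae_ge0_le_integral => //.
- by move=> w _; rewrite lee_fin lift_step_ge0.
- by apply/measurable_EFinP; apply: measurable_funTS; exact: measurable_lift_step.
- apply: filterS (ae_regular j) => w rw _ /=.
  by rewrite lee_fin (le_trans (ler_norm _)) // HB.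
Qed.

Lemma block_mean_ge0 j i a b : (0 <= block_mean j i a b)%E.
Proof. by apply: integral_ge0 => w _; rewrite lee_fin lift_step_ge0. Qed.

Lemma block_mean_fin j i a b : block_mean j i a b \is a fin_num.
Proof.
have [B B0 HB] := block_mean_le; rewrite ge0_fin_numE ?block_mean_ge0 //.
apply: (le_lt_trans (HB j i a b)); rewrite -ge0_fin_numE ?mule_ge0 //.
by rewrite fin_numM // fin_num_measure //; exact: measurable_mode.
Qed.

(** The factor [p_ji] cancels the denominator of the conditional mean; where it is 0,
    the expectation over the null event is 0 too. *)
Lemma transition_mx_block j i a b : (submxblock TM i j a b)%:E = block_mean j i a b.
Proof.
rewrite /transition_mx mxblockK mxE mxE /trans_prob /cond_prob /cond_mean.
rewrite !(mode0 smX) !setTI setIT probability_setT /= divr1.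
have mM : measurable (@mode_is _ _ _ (X j) 1 i) by exact: measurable_mode.
have -> : (\int[Prob (X j)]_(w in mode_is 1 i)
    (lift_mx m (reset 0 w *m expmx (holding 0 w *: A (mode 0 w))) a b)%:E)%E =
    block_mean j i a b.
  have m0 (w : Omega (X j)) : mode 0 w = j by have [] := smX.
  apply: ae_eq_integral => //.
  - apply/measurable_EFinP; apply: measurable_funTS.
    have mJ : mx_measurable (reset 0 : Omega (X j) -> 'M[R]_n).
      by move=> c d; apply: (measurableT_comp (borel_mat_coord c d)); exact: measurable_reset_fun.
    apply: mx_measurable_lift; apply: mx_measurable_mul => //.
    by apply: mx_measurable_expmx; [move=> l; exact: measurable_mode|exact: measurable_holding].
  - by apply/measurable_EFinP; apply: measurable_funTS; exact: measurable_lift_step.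
  - apply: filterS (ae_regular j) => w rw _; rewrite m0 /step_mx /= absmx_id //.
    by have [] := rw 0%N.
have PM : Prob (X j) (mode_is 1 i) = (fine (Prob (X j) (mode_is 1 i)))%:E.
  by rewrite fineK // fin_num_measure.
have [P0|P0] := eqVneq (fine (Prob (X j) (mode_is 1 i))) 0; last first.
  by rewrite mulrCA divff // mulr1 fineK // block_mean_fin.
rewrite P0 mul0r; apply/eqP; rewrite eq_le block_mean_ge0 /=.
have [B B0 HB] := block_mean_le; apply: (le_trans (HB j i a b)).
by rewrite PM P0 mule0.
Qed.

Lemma cocycle_measurable s k a b :
  measurable_fun [set: Omega (X s)] (fun w => lift_mx m (cocycle A k w) a b).
Proof.
apply: (@history_measurable_fun _ _ _ (X s) k).
exact: lift_cocycle_history_measurable.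
Qed.

Lemma lift_cocycle_ge0 s k (w : Omega (X s)) a b : 0 <= lift_mx m (cocycle A k w) a b.
Proof. by apply: lift_mx_ge0; apply: cocycle_ge0; exact: posX.1. Qed.

(** The lift of [J_k e^(h_k A) M_k] is the product of the lifts of its two factors,
    which are independent given [sigma_k]; sum over the values of [sigma_k]. *)
Lemma moment_power s k i a b :
  (\int[Prob (X s)]_(w in mode_is k i) (lift_mx m (cocycle A k w) a b)%:E)%E =
  (submxblock (TM ^+ k) i s a b)%:E.
Proof.
elim: k i a b => [|k IHk] i a b.
  rewrite expr0 -[1]/(1%:M) -mxdiagZ /mxdiag mxblockK.
  under eq_integral do rewrite /cocycle /= lift_mx1.
  have m0 (w : Omega (X s)) : mode 0 w = s by have [] := smX.
  have [<-|si] := eqVneq i s.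
    rewrite conform_mx_id (mode0 smX) integral_cst //.
    by rewrite -[RHS]mule1; congr (_ * _)%E; exact: probability_setT.
  have -> : @mode_is _ _ _ (X s) 0 i = set0.
    by apply/seteqP; split=> // w wi; rewrite -wi m0 eqxx in si.
  by rewrite integral_set0 mxE.
have mM l j : measurable (@mode_is _ _ _ (X s) l j) by exact: measurable_mode.
rewrite (integral_modes k) //; last 2 first.
- by apply/measurable_EFinP; apply: measurable_funTS; exact: cocycle_measurable.
- by move=> w _; rewrite lee_fin lift_cocycle_ge0.
rewrite exprS -[TM * _]/(TM *m _) -[X in X *m _]submxblockK -[X in _ *m X]submxblockK.
rewrite mul_mxblock mxblockK summxE -sumEFin; apply: eq_bigr => j _.
rewrite mxE -sumEFin.
transitivity (\sum_c \int[Prob (X s)]_(w in mode_is k j `&` mode_is k.+1 i)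
   (lift_mx m (cocycle A k w) c b *
    `|lift_mx m (step_mx A j (holding k w, reset k w)) a c|)%:E)%E.
  rewrite -ge0_integral_sum //; last 3 first.
  - by apply: measurableI.
  - move=> c; apply/measurable_EFinP; apply: measurable_funTS.
    apply: measurable_funM; first exact: cocycle_measurable.
    by apply: measurableT_comp => //; exact: measurable_lift_step.
  - by move=> c w _; rewrite lee_fin mulr_ge0 // lift_cocycle_ge0.
  rewrite setIC; apply: eq_integral => w; rewrite inE => -[wj _].
  rewrite sumEFin cocycleS lift_mxM mxE; congr EFin; apply: eq_bigr => c _.
  rewrite mulrC [X in step_mx _ X]wj; congr (_ * _).
  by rewrite ger0_norm // lift_step_ge0.
apply: eq_bigr => c _.
pose phi y : R := `|lift_mx m (step_mx A j y) a c|.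
rewrite (@semi_markov_integral _ _ _ _ smX s k j i (fun w => lift_mx m (cocycle A k w) c b) phi) //.
- rewrite IHk mulrC EFinM; congr (_ * _)%E; rewrite transition_mx_block.
  by apply: eq_integral => w _; rewrite /phi ger0_norm // lift_step_ge0.
- apply: history_preimage.
  exact: lift_cocycle_history_measurable.
- by move=> w; exact: lift_cocycle_ge0.
- apply: measurableT_comp => //.
  exact: (mx_measurable_lift (mx_measurable_step A j)).
- by move=> y; exact: normr_ge0.
Qed.

End Moments.

(** * Switching times tend to infinity *)

Lemma ae_probability1 d (S : measurableType d) (R : realType) (P : probability S R) (E : set S) :
  measurable E -> {ae P, forall w, E w} -> P E = 1%E.
Proof.
move=> mE aeE; have PC : P (~` E) = 0%E.
  move: aeE => [F [mF F0 EF]]; apply: (subset_measure0 _ mF _ F0) => //.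
  exact: measurableC.
have := probability_setC P mE; rewrite PC => /esym/eqP.
by rewrite sube_eq ?fin_num_measure // add0e => /eqP ->.
Qed.

Section SwitchingTimes.
Context (R : realType) (N n : nat) (X : 'I_N -> switching R N n).
Hypothesis smX : semi_markovian X.

Lemma semi_markov_total s k j (g : Omega (X s) -> R) (phi : R * borel_mat R n n -> R) :
  measurable_fun [set: history_space (X s) k] (g : history_space (X s) k -> R) ->
  (forall w, 0 <= g w) -> measurable_fun [set: R * borel_mat R n n] phi ->
  (forall y, 0 <= phi y) ->
  (\int[Prob (X s)]_(w in mode_is k j) (g w * phi (holding k w, reset k w))%:E =
   \int[Prob (X s)]_(w in mode_is k j) (g w)%:E *
   \int[Prob (X j)]_w (phi (holding 0 w, reset 0 w))%:E)%E.
Proof.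
move=> mg g0 mphi phi0.
have mphiq (Z : switching R N n) l :
    measurable_fun [set: Omega Z] (fun w : Omega Z => phi (holding l w, reset l w)).
  exact: (measurableT_comp mphi (@measurable_holding_reset R N n Z l)).
rewrite (@integral_modes _ _ _ (X s) k.+1); last 3 first.
- exact: measurable_mode.
- apply/measurable_EFinP; apply: measurable_funTS; apply: measurable_funM => //.
  exact: history_measurable_fun mg.
- by move=> w _; rewrite lee_fin mulr_ge0.
rewrite (@integral_modes _ _ _ (X j) 1 setT) //; last 2 first.
- exact/measurable_EFinP.
- by move=> w _; rewrite lee_fin.
rewrite ge0_sume_distrr => [|i _]; last by apply: integral_ge0 => w _; rewrite lee_fin.
apply: eq_bigr => i _; rewrite setTI; apply: semi_markov_integral => //.
exact: history_preimage.
Qed.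

Hypothesis hpos : forall s k, {ae Prob (X s), forall w, 0 < holding k w}.

(** From each of the finitely many modes, the probability of [delta <= h_0] tends to 1
    as [delta] tends to 0. *)
Lemma holding_lower_bound : exists2 delta, 0 < delta &
  forall j, (2^-1%:E <= Prob (X j) [set w | (delta <= holding 0 w)%R])%E.
Proof.
pose F j p : set (Omega (X j)) := [set w | (p.+1%:R^-1 <= holding 0 w)%R].
have mF j p : measurable (F j p) by exact: measurable_holding_ge.
have ndF j : nondecreasing_seq (F j).
  move=> p q pq; apply/subsetPset => w /=; apply: le_trans.
  by rewrite lef_pV2 ?posrE // ler_nat ltnS.
have mU j : measurable (\bigcup_p F j p) by exact: bigcup_measurable.
have PU j : Prob (X j) (\bigcup_p F j p) = 1%E.
  apply: ae_probability1 => //; apply: filterS (hpos j 0%N) => w hw.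
  exists (Num.bound (holding 0 w)^-1) => //=; rewrite /F /= -[leRHS]invrK.
  rewrite lef_pV2 ?posrE ?invr_gt0 //; apply: ltW.
  apply: (lt_trans (archi_boundP _)); first by rewrite invr_ge0 ltW.
  by rewrite ltr_nat.
have exp j : exists p, (2^-1%:E <= Prob (X j) (F j p))%E.
  have : Prob (X j) (F j p) @[p --> \oo] --> 1%E.
    by rewrite -(PU j); exact: (nondecreasing_cvg_mu (mu := Prob (X j)) (mF j) (mU j) (ndF j)).
  move=> /fine_cvgP[_ /cvgrPdist_lt /(_ 2^-1)].
  rewrite invr_gt0 ltr0n => /(_ isT) [p _ /(_ p (leqnn p)) /=] H.
  exists p; rewrite -[leRHS]fineK ?fin_num_measure // lee_fin.
  by move: H; rewrite ltr_distl => /andP[_ H]; rewrite ltW //; lra.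
pose p := (\sum_j projT1 (cid (exp j)))%N.
exists p.+1%:R^-1; first by rewrite invr_gt0.
move=> j; have := projT2 (cid (exp j)); move/le_trans; apply.
apply: le_measure; rewrite ?inE //.
  exact: mF j p.
by apply/subsetPset/ndF; rewrite /p (bigD1 j) //= leq_addr.
Qed.

Let exp_holding : exists2 q, 0 < q < 1 & forall j,
  (\int[Prob (X j)]_w (expR (- holding 0 w))%:E <= q%:E)%E.
Proof.
have [delta d0 Hd] := holding_lower_bound.
have e1 : expR (- delta) < 1 by rewrite expR_lt1 oppr_lt0.
have e0 : 0 < expR (- delta) by exact: expR_gt0.
exists ((1 + expR (- delta)) / 2); first by apply/andP; split; lra.
move=> j; pose D := [set w : Omega (X j) | delta <= holding 0 w].
have mD : measurable D by exact: measurable_holding_ge.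
have mexp : measurable_fun [set: Omega (X j)] (fun w => (expR (- holding 0 w))%:E).
  apply/measurable_EFinP; apply: measurableT_comp => //.
  by apply: measurableT_comp => //; exact: measurable_holding.
rewrite -(setvU D) setUC (ge0_integral_setU _ mD (measurableC mD));
  [|exact: measurable_funTS|by move=> w _; rewrite lee_fin expR_ge0|exact/disj_setPCl].
apply: (@le_trans _ _ ((expR (- delta))%:E * Prob (X j) D + 1%:E * Prob (X j) (~` D))%E).
  rewrite -!integral_cst //; last exact: measurableC.
  apply: leeD; apply: ge0_le_integral => //; try exact: measurableC.
  - exact: measurable_funTS.
  - by move=> w Dw; rewrite lee_fin ler_expR lerN2.
  - exact: measurable_funTS.
  - by move=> w _; rewrite lee_fin -expR0 ler_expR oppr_le0 holding_ge0.
rewrite probability_setC //; have := Hd j; rewrite -/D.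
have Pfin : Prob (X j) D \is a fin_num by exact: fin_num_measure.
rewrite -(fineK Pfin) -EFinB -!EFinM -EFinD !lee_fin => p2.
have : (1 - expR (- delta)) * 2^-1 <= (1 - expR (- delta)) * fine (Prob (X j) D).
  by rewrite ler_wpM2l // subr_ge0 ltW.
lra.
Qed.

Let exp_time : exists2 q, 0 < q < 1 & forall s k,
  (\int[Prob (X s)]_w (expR (- time k w))%:E <= (q ^+ k)%:E)%E.
Proof.
have [q q01 Hq] := exp_holding; exists q => // s; have [q0 q1] := andP q01.
elim=> [|k IHk].
  rewrite expr0; under eq_integral do rewrite time0 oppr0 expR0.
  by rewrite integral_cst // mul1e probability_le1.
have mt l : measurable_fun [set: Omega (X s)] (fun w => expR (- time l w)).
  by apply: measurableT_comp => //; apply: measurableT_comp => //; exact: measurable_time.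
have mexp : measurable_fun [set: history_space (X s) k]
    ((fun w => expR (- time k w)) : history_space (X s) k -> R).
  apply: measurableT_comp => //; apply: measurableT_comp => //.
  exact: history_time_measurable.
have mphi : measurable_fun [set: R * borel_mat R n n] (fun y => expR (- y.1)).
  apply: measurableT_comp => //; apply: measurableT_comp => //; exact: measurable_fst.
rewrite (@integral_modes _ _ _ (X s) k);
  [|by []|exact/measurable_EFinP|by move=> w _; rewrite lee_fin expR_ge0].
apply: (@le_trans _ _ (\sum_j (\int[Prob (X s)]_(w in setT `&` mode_is k j)
    (expR (- time k w))%:E) * q%:E)%E).
  apply: lee_sum => j _; rewrite !setTI.
  under eq_integral => w _.
    have -> : expR (- time k.+1 w) = expR (- time k w) * expR (- (holding k w, reset k w).1).
      by rewrite -expRD /= /holding; congr expR; ring.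
    over.
  rewrite (@semi_markov_total s k j (fun w => expR (- time k w)) (fun y => expR (- y.1))) //.
  by apply: lee_wpmul2l; [apply: integral_ge0 => w _; rewrite lee_fin expR_ge0|exact: Hq].
rewrite -ge0_sume_distrl => [|j _]; last by apply: integral_ge0 => w _; rewrite lee_fin expR_ge0.
rewrite -integral_modes;
  [|by []|exact/measurable_EFinP|by move=> w _; rewrite lee_fin expR_ge0].
rewrite exprSr EFinM; apply: lee_wpmul2r => //.
by rewrite lee_fin ltW.
Qed.

(** Holding times are independent of the past given the current mode, and their
    laws are among finitely many laws on the positive reals; hence [E e^(-t_k)]
    decays geometrically. *)
Lemma ae_time_unbounded s : {ae Prob (X s), forall w, forall u, exists k, u < time k w}.
Proof.
have [q q01 Hq] := exp_time; have [q0 q1] := andP q01.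
pose B p : set (Omega (X s)) := \bigcap_k [set w | time k w <= p%:R].
have mle k p : measurable [set w : Omega (X s) | time k w <= p%:R].
  rewrite (_ : [set w | _] = time k @^-1` `]-oo, p%:R]%classic); last first.
    by apply/seteqP; split=> w /=; rewrite in_itv.
  by rewrite -[_ @^-1` _]setTI; exact: measurable_time.
have mB p : measurable (B p) by exact: bigcapT_measurable.
have PB p : Prob (X s) (B p) = 0%E.
  (* Markov's inequality for [e^(-t_k)] *)
  have PBk k : (Prob (X s) (B p) <= (expR p%:R * q ^+ k)%:E)%E.
    have : (Prob (X s) [set w | (time k w <= p%:R)%R] <= (expR p%:R * q ^+ k)%:E)%E.
      have mexp : measurable_fun [set: Omega (X s)] (fun w => (expR (- time k w))%:E).
        apply/measurable_EFinP; apply: measurableT_comp => //.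
        by apply: measurableT_comp => //; exact: measurable_time.
      have : ((expR (- p%:R))%:E * Prob (X s) [set w | (time k w <= p%:R)%R] <= (q ^+ k)%:E)%E.
        apply: le_trans (Hq s k); rewrite -integral_cst //.
        apply: (@le_trans _ _ (\int[Prob (X s)]_(w in [set w | (time k w <= p%:R)%R])
            (expR (- time k w))%:E)%E).
          apply: ge0_le_integral => //.
          - by move=> w _; rewrite lee_fin expR_ge0.
          - exact: measurable_funTS.
          - by move=> w /= wp; rewrite lee_fin ler_expR lerN2.
        by apply: ge0_subset_integral => // w _; rewrite lee_fin expR_ge0.
      have Pfin : Prob (X s) [set w | time k w <= p%:R] \is a fin_num by exact: fin_num_measure.
      rewrite -(fineK Pfin) -EFinM !lee_fin expRN mulrC ler_pdivrMr ?expR_gt0 //.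
      by rewrite mulrC.
    apply: le_trans; apply: le_measure; rewrite ?inE //.
    by move=> w; apply.
  have Pfin : Prob (X s) (B p) \is a fin_num by exact: fin_num_measure.
  apply/eqP; rewrite eq_le measure_ge0 andbT -(fineK Pfin) lee_fin.
  have lim : expR p%:R * q ^+ k @[k --> \oo] --> (0 : R).
    by apply: cvg_geometric; rewrite ger0_norm // ltW.
  apply: (ler_cvg_to (cvg_cst _) lim); apply: nearW => k.
  by have := PBk k; rewrite -(fineK Pfin) lee_fin.
have : {ae Prob (X s), forall w, forall p, ~ B p w}.
  apply/ae_foralln => p; exists (B p); split; [exact: mB|exact: PB|by move=> w /= /contrapT].
apply: filterS => w wB u; apply/not_existsP => H.
apply: (wB (Num.bound `|u|)) => k _ /=.
have /negP := H k; rewrite -leNgt => /le_trans; apply.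
by apply: (le_trans (ler_norm u)); apply: ltW; exact: archi_boundP.
Qed.

End SwitchingTimes.

(** * Lifts and norms at the switching times *)

Section Norms.
Context (R : realType) (n : nat).

Lemma norm_mulmx_le (M : 'M[R]_n) (x : 'cV[R]_n) (C : R) :
  0 <= C -> (forall i j, `|M i j| <= C) -> `|M *m x| <= (n%:R * C) * `|x|.
Proof.
move=> C0 MC; apply: norm_le_coord => [|i j]; first by rewrite !mulr_ge0.
rewrite mxE; apply: (le_trans (ler_norm_sum _ _ _)).
apply: (@le_trans _ _ (\sum_(k < n) C * `|x|)).
  by apply: ler_sum => k _; rewrite normrM ler_pM // coord_le_norm.
by rewrite sumr_const card_ord -[leLHS]mulr_natl mulrA.
Qed.

(** For the supremum norm, a nonnegative matrix attains its operator norm at the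
    vector of ones. *)
Lemma norm_nonneg_mulmx (M : 'M[R]_n) (x : 'cV[R]_n) :
  nonneg_mx M -> `|M *m x| <= `|M *m (const_mx 1 : 'cV[R]_n)| * `|x|.
Proof.
move=> M0; apply: norm_le_coord => [|i j]; first by rewrite mulr_ge0.
rewrite mxE; apply: (le_trans (ler_norm_sum _ _ _)).
apply: (@le_trans _ _ ((M *m (const_mx 1 : 'cV[R]_n)) i 0 * `|x|)).
  rewrite mxE mulr_suml; apply: ler_sum => k _.
  by rewrite mxE mulr1 normrM ger0_norm // ler_wpM2l // coord_le_norm.
by rewrite ler_wpM2r // (le_trans (ler_norm _)) // coord_le_norm.
Qed.

Lemma norm_ones_le1 : `|const_mx 1 : 'cV[R]_n| <= 1.
Proof. by apply: norm_le_coord => // i j; rewrite mxE normr1. Qed.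

Lemma geometric_sum_le (r : R) p : 0 < r < 1 -> \sum_(l < p) r ^+ l <= (1 - r)^-1.
Proof.
move=> /andP[r0 r1]; have d0 : 0 < 1 - r by rewrite subr_gt0.
rewrite -[leRHS]mul1r ler_pdivlMr // mulrC -opprB mulNr -subrX1 opprB.
by rewrite lerBlDr lerDl exprn_ge0 // ltW.
Qed.

End Norms.

Section Comparison.
Context (R : realType) (N n m : nat) (A : 'I_N -> 'M[R]_n) (X : 'I_N -> switching R N n).
Variables (T K : R).
Hypothesis m0 : (0 < m)%N.
Hypotheses (smX : semi_markovian X) (posX : positive_system A X).
Hypothesis hX : forall s k, {ae Prob (X s), forall w, 0 < holding k w <= T}.
Hypothesis JX : forall s k, {ae Prob (X s), forall w, `|reset k w| <= K}.

Local Notation TM := (transition_mx A m X).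
Local Notation ones := (const_mx 1 : 'cV[R]_n).
Local Notation kappa := (lift_const n m R).

Lemma regular_time_incr s (w : Omega (X s)) : regular T K w -> forall k, time k w < time k.+1 w.
Proof. by move=> rw k; have [/andP[h0 _] _ _] := rw k; rewrite -subr_gt0. Qed.

Lemma regular_time_le s (w : Omega (X s)) : regular T K w -> forall k, time k w <= k%:R * T.
Proof.
move=> rw; elim=> [|k IHk]; first by rewrite time0 mul0r.
have [/andP[_ hT] _ _] := rw k.
by rewrite -natr1 mulrDl mul1r -[time _ _](subrK (time k w)) addrC lerD.
Qed.

Lemma regular_flow s (w : Omega (X s)) : regular T K w -> forall k,
  flow A (fun l => mode l w) (fun l => time l w) (fun l => reset l w) k = cocycle A k w.
Proof.
move=> rw; rewrite /cocycle; elim=> //= k ->; congr (_ *m _ *m _).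
by rewrite absmx_id //; have [] := rw k.
Qed.

Definition lift_sum s k (w : Omega (X s)) : R := \sum_a \sum_b lift_mx m (cocycle A k w) a b.

Lemma lift_sum_ge0 s k (w : Omega (X s)) : 0 <= lift_sum k w.
Proof. by do 2![rewrite sumr_ge0 // => ? _]; exact: (lift_cocycle_ge0 posX). Qed.

Lemma cocycle_ones_ge0 s k (w : Omega (X s)) l : 0 <= (cocycle A k w *m ones) l 0.
Proof.
rewrite mxE sumr_ge0 // => c _; rewrite [X in _ * X]mxE mulr1.
by apply: cocycle_ge0; exact: posX.1.
Qed.

Lemma norm_cocycle_le s k (w : Omega (X s)) :
  `|cocycle A k w *m ones| ^+ m <= kappa ^+ 2 * lift_sum k w.
Proof.
apply: (le_trans (norm_le_lift_vec _ m0)); rewrite expr2 -mulrA.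
rewrite ler_wpM2l ?lift_const_ge0 // mulr_sumr; apply: ler_sum => a _.
rewrite ger0_norm; last by apply: lift_vec_ge0 => l; exact: cocycle_ones_ge0.
rewrite lift_vec_mulmx mxE mulr_sumr; apply: ler_sum => b _.
rewrite mulrC; apply: ler_wpM2r; first exact: (lift_cocycle_ge0 posX).
apply: (le_trans (ler_norm _)); apply: (le_trans (lift_vec_le_norm _ _)).
by rewrite ler_piMr ?lift_const_ge0 // exprn_ile1 // norm_ones_le1.
Qed.

(** The lift of the vector of ones is positive and that of the cocycle is nonnegative,
    so up to a constant each entry of the latter is at most its row sum against the
    former. *)
Lemma lift_cocycle_le s k (w : Omega (X s)) a b :
  lift_mx m (cocycle A k w) a b <= kappa ^+ 2 * `|cocycle A k w *m ones| ^+ m.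
Proof.
have v0 := lift_vec_const1_gt0 R (b : 'I_(lift_dim n m)).
have vE : lift_vec m ones b 0 = mono_coef R b.
  by rewrite lift_vec_word big1 ?mulr1 // => t _; rewrite mxE.
apply: (@le_trans _ _ ((mono_coef R b)^-1 * lift_vec m (cocycle A k w *m ones) a 0)).
  rewrite lift_vec_mulmx mxE (bigD1 b) //= -vE mulrDr mulrCA mulVf ?gt_eqF // mulr1.
  rewrite lerDl mulr_ge0 ?invr_ge0 ?(ltW v0) // sumr_ge0 // => c _.
  by rewrite mulr_ge0 ?(lift_cocycle_ge0 posX) // ltW // lift_vec_const1_gt0.
rewrite expr2 -mulrA; apply: ler_pM.
- by rewrite invr_ge0 ltW // mono_coef_gt0.
- by apply: lift_vec_ge0 => l; exact: cocycle_ones_ge0.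
- apply: le_trans (lift_const_ge R b).
  by rewrite lerDr ltW // mono_coef_gt0.
- exact: le_trans (ler_norm _) (lift_vec_le_norm _ _).
Qed.

Lemma measurable_lift_sum s k : measurable_fun [set: Omega (X s)] (@lift_sum s k).
Proof.
by apply: measurable_sum => a; apply: measurable_sum => b; exact: cocycle_measurable.
Qed.

Lemma integral_lift_sum s k :
  (\int[Prob (X s)]_w (lift_sum k w)%:E)%E =
  (\sum_i \sum_a \sum_b submxblock (TM ^+ k) i s a b)%:E.
Proof.
rewrite (@integral_modes _ _ _ (X s) k);
  [|by []|by apply/measurable_EFinP; exact: measurable_lift_sum
   |by move=> w _; rewrite lee_fin lift_sum_ge0].
rewrite -sumEFin; apply: eq_bigr => i _; rewrite setTI.
have mM : measurable (@mode_is _ _ _ (X s) k i) by exact: measurable_mode.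
have mL a b : measurable_fun (mode_is k i)
    (fun w : Omega (X s) => (lift_mx m (cocycle A k w) a b)%:E).
  by apply/measurable_EFinP; apply: measurable_funTS; exact: cocycle_measurable.
have L0 a b (w : Omega (X s)) : (0 <= (lift_mx m (cocycle A k w) a b)%:E)%E.
  by rewrite lee_fin (lift_cocycle_ge0 posX).
under eq_integral do rewrite /lift_sum -sumEFin.
rewrite ge0_integral_sum //; last 2 first.
- move=> a; apply/measurable_EFinP; apply: measurable_sum => b.
  by apply: measurable_funTS; exact: cocycle_measurable.
- by move=> a w _; rewrite -sumEFin sume_ge0.
rewrite -sumEFin; apply: eq_bigr => a _.
under eq_integral do rewrite -sumEFin.
rewrite ge0_integral_sum // -sumEFin; apply: eq_bigr => b _.
exact: (moment_power smX posX hX JX).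
Qed.

Lemma norm_solution_measurable s (x : R -> Omega (X s) -> 'cV[R]_n) u :
  (forall u B, borel_mx B -> measurable (x u @^-1` B)) ->
  measurable_fun [set: Omega (X s)] (fun w => `|x u w| ^+ m).
Proof.
move=> mx; apply: measurable_funX.
have mxu : measurable_fun [set: Omega (X s)] (x u : Omega (X s) -> borel_mat R n 1).
  by move=> _ B mB; rewrite setTI; exact: mx.
exact: (measurableT_comp (@borel_mat_norm R n 1) mxu).
Qed.

End Comparison.

(** * Spectral radius below one implies stability *)

Section Sufficiency.
Context (R : realType) (N n m : nat) (A : 'I_N -> 'M[R]_n) (X : 'I_N -> switching R N n).
Variables (T K : R).
Hypotheses (m0 : (0 < m)%N) (T0 : 0 < T).
Hypotheses (smX : semi_markovian X) (posX : positive_system A X).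
Hypothesis hX : forall s k, {ae Prob (X s), forall w, 0 < holding k w <= T}.
Hypothesis JX : forall s k, {ae Prob (X s), forall w, `|reset k w| <= K}.

Local Notation TM := (transition_mx A m X).
Local Notation ones := (const_mx 1 : 'cV[R]_n).
Local Notation kappa := (lift_const n m R).

Let hpos s k : {ae Prob (X s), forall w, 0 < holding k w}.
Proof. by apply: filterS (hX s k) => w /andP[]. Qed.

(** At time [u] at least [u / T - 1] switches have occurred. Hence the norm of the
    state to the power [m] is at most a constant times the sum over [k >= k0] of the
    lifts after [k] switches, with [k0] the integer part of [u / T]; the expectation
    of this sum is the tail of a geometric series. *)
Lemma spectral_radius_lt1_stable : spectral_radius TM < 1 -> exp_mean_stable A m X.
Proof.
move=> /spectral_radius_lt1_decay[C [r [C0 r01 TMC]]]; have [r0 r1] := andP r01.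
have [Ce Ce0 HCe] := expmx_bounded_modes A T.
pose D : R := (n%:R * Ce) ^+ m * kappa ^+ 2.
have D0 : 0 <= D by rewrite mulr_ge0 ?exprn_ge0 ?mulr_ge0 ?lift_const_ge0 // ltW.
pose c : R := \sum_(i < N) \sum_(a < lift_dim n m) \sum_(b < lift_dim n m) C.
have c0 : 0 <= c.
  by do 3![rewrite sumr_ge0 // => ? _]; exact: ltW.
have EW s k : (\int[Prob (X s)]_w (lift_sum m A k w)%:E <= (c * r ^+ k)%:E)%E.
  rewrite (integral_lift_sum m smX posX hX JX) lee_fin /c mulr_suml; apply: ler_sum => i _.
  rewrite mulr_suml; apply: ler_sum => a _; rewrite mulr_suml; apply: ler_sum => b _.
  by rewrite mxE (le_trans (ler_norm _)) // TMC.
(* This rate gives [r ^ (u / T) = e ^ (- beta * u)]. *)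
pose beta : R := - ln r / T.
have beta0 : 0 < beta by rewrite divr_gt0 // oppr_gt0 ln_lt0.
have r10 : 0 <= 1 - r by rewrite subr_ge0 ltW.
(* The last factor makes up for rounding [u / T] down. *)
pose C' : R := D * c * (1 - r)^-1 * r^-1.
have C'0 : 0 <= C'.
  apply: mulr_ge0; rewrite ?invr_ge0 ?(ltW r0) //.
  by apply: mulr_ge0; rewrite ?invr_ge0 //; exact: mulr_ge0.
exists (1 + C'), beta; split=> // [|s x0 x [mx xsol] u u0]; first by rewrite ltr_pwDl.
pose k0 := Num.truncn (u / T).
have uT0 : 0 <= u / T by rewrite divr_ge0 // ltW.
have [k0u uk0] := andP (truncn_itv uT0).
pose E : R := D * `|x0| ^+ m.
have E0 : 0 <= E by rewrite mulr_ge0 ?exprn_ge0.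
pose f l (w : Omega (X s)) : \bar R := (E * lift_sum m A (k0 + l) w)%:E.
have f0 l w : (0 <= f l w)%E by rewrite lee_fin mulr_ge0 // (lift_sum_ge0 m posX).
have mf l : measurable_fun [set: Omega (X s)] (f l).
  by apply/measurable_EFinP; apply: measurable_funM => //; exact: measurable_lift_sum.
have bound : {ae Prob (X s), forall w,
    ((`|x u w| ^+ m)%:E <= \sum_(l <oo) f l w)%E}.
  apply: filterS3 xsol (ae_regular posX hX JX s) (ae_time_unbounded smX hpos s)
    => w traj rw unb.
  have [k ku] : exists k, time k w <= u < time k.+1 w.
    have ex : exists k, u < time k w by exact: unb.
    case: (ex_minnP ex) => -[|k]; first by rewrite time0 ltNge u0.
    move=> uk min; exists k; rewrite uk andbT leNgt; apply/negP => /min.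
    by rewrite ltnn.
  have [l kl] : exists l, k = (k0 + l)%N.
    suff : (k0 <= k)%N by move=> H; exists (k - k0)%N; rewrite subnKC.
    rewrite -ltnS; rewrite -(ltr_nat R); apply: (le_lt_trans k0u).
    rewrite ltr_pdivrMr //; have [_ /lt_le_trans] := andP ku; apply.
    exact: regular_time_le.
  apply: (@le_trans _ _ (f l w)); last first.
    apply: le_trans (nneseries_lim_ge (m := 0) (P := xpredT) l.+1 _) => //.
    by rewrite big_nat_recr //= leeDr // sume_ge0.
  have xE := trajectory_flow (time0 w) (regular_time_incr rw) traj ku.
  rewrite lee_fin {}xE (regular_flow A rw) /E /D -kl.
  have [ku1 ku2] := andP ku.
  have hk : `|u - time k w| <= T.
    rewrite ger0_norm ?subr_ge0 //; have [/andP[_ hT] _ _] := rw k.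
    by apply: le_trans hT; rewrite lerB // ltW.
  have n1 := norm_mulmx_le (cocycle A k w *m x0) (ltW Ce0)
    (fun i j => HCe (mode k w) _ i j hk).
  have n2 := norm_nonneg_mulmx x0 (cocycle_ge0 posX.1 k w).
  apply: (@le_trans _ _ (((n%:R * Ce) * (`|cocycle A k w *m ones| * `|x0|)) ^+ m)).
    rewrite lerXn2r ?nnegrE ?mulr_ge0 ?(ltW Ce0) //.
    by apply: (le_trans n1); rewrite ler_wpM2l // mulr_ge0 // ltW.
  have n3 := norm_cocycle_le m0 posX k w.
  move: (kappa ^+ 2) n3 => q n3; rewrite exprMn [X in _ * X]exprMn -!mulrA.
  apply: ler_wpM2l; first by rewrite exprn_ge0 // mulr_ge0 // ltW.
  by rewrite [leLHS]mulrC [leRHS]mulrCA; apply: ler_wpM2l; rewrite ?exprn_ge0.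
have -> : ('E_(Prob (X s))[fun w => (`|x u w| ^+ m)%R] = \int[Prob (X s)]_w (`|x u w| ^+ m)%:E)%E.
  by rewrite unlock.
apply: (@le_trans _ _ (\int[Prob (X s)]_w \sum_(l <oo) f l w)%E).
  apply: ae_ge0_le_integral => //.
  - by apply/measurable_EFinP; exact: norm_solution_measurable.
  - by move=> w _; exact: nneseries_ge0.
  - by apply: ge0_emeasurable_sum => // l w _ _; exact: f0.
  - by apply: filterS bound => w H _.
rewrite integral_nneseries //.
apply: (@le_trans _ _ (E * c * r ^+ k0 * (1 - r)^-1)%:E).
  apply: lime_le.
    by apply: is_cvg_nneseries => l _ _; apply: integral_ge0 => w _; exact: f0.
  apply: nearW => p; rewrite big_mkord.
  apply: (@le_trans _ _ (\sum_(l < p) (E * c * r ^+ k0 * r ^+ l)%:E)%E).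
    apply: lee_sum => l _; rewrite /f; under eq_integral do rewrite EFinM.
    rewrite ge0_integralZl_EFin //; last 2 first.
    - by move=> w _; rewrite lee_fin (lift_sum_ge0 m posX).
    - by apply/measurable_EFinP; exact: measurable_lift_sum.
    rewrite -[X in (_ <= (X)%:E)%E]mulrA -exprD -mulrA [leRHS]EFinM.
    by rewrite lee_wpmul2l ?lee_fin //; exact: EW.
  rewrite sumEFin lee_fin -mulr_sumr ler_wpM2l //; last exact: geometric_sum_le.
  by apply: mulr_ge0; [exact: mulr_ge0|rewrite exprn_ge0 // ltW].
rewrite lee_fin.
have decay : r ^+ k0 <= r^-1 * expR (- beta * u).
  have -> : - beta * u = ln r * (u / T) by rewrite /beta; field; rewrite gt_eqF.
  rewrite -{1}(lnK (x := r)) ?posrE // -expRM_natl.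
  have -> : r^-1 = expR (- ln r) by rewrite expRN lnK ?posrE.
  rewrite -expRD ler_expR.
  have ln0 : ln r < 0 by exact: ln_lt0.
  have : (ln r) * k0.+1%:R <= ln r * (u / T) by rewrite ler_nM2l // ltW.
  by rewrite -natr1 mulrDr mulr1 mulr_natl mulr_natr; lra.
apply: (@le_trans _ _ (C' * expR (- beta * u) * `|x0| ^+ m)); last first.
  by rewrite ler_wpM2r ?exprn_ge0 // ler_wpM2r ?expR_ge0 // lerDr.
have -> : E * c * r ^+ k0 * (1 - r)^-1 = (D * c * (1 - r)^-1 * `|x0| ^+ m) * r ^+ k0.
  by rewrite /E; ring.
have -> : C' * expR (- beta * u) * `|x0| ^+ m =
    (D * c * (1 - r)^-1 * `|x0| ^+ m) * (r^-1 * expR (- beta * u)).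
  by rewrite /C'; ring.
apply: ler_wpM2l => //; apply: mulr_ge0; rewrite ?exprn_ge0 //.
by apply: mulr_ge0; [exact: mulr_ge0|rewrite invr_ge0].
Qed.

End Sufficiency.

(** * Stability implies spectral radius below one *)

(** An interval of length at least [delta] contains a multiple of [delta], and disjoint
    intervals contain different ones. *)
Lemma sampling_sum_le (R : realType) (t F G : nat -> R) (delta : R) L M :
  0 < delta -> 0 <= t 0%N -> (forall k, t k <= t k.+1) -> t L <= M%:R * delta ->
  (forall j, 0 <= G j) ->
  (forall k j, t k <= j%:R * delta < t k.+1 -> F k <= G j) ->
  \sum_(k < L) F k * (delta <= t k.+1 - t k)%R%:R <= \sum_(j < M) G j.
Proof.
move=> d0 t0 tnd tL G0 FG.
pose hit k j := t k <= j%:R * delta < t k.+1.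
apply: (@le_trans _ _ (\sum_(k < L) \sum_(j < M) G j * (hit k j)%:R)).
  apply: ler_sum => k _; have [dk|_] := boolP (delta <= _); last first.
    by rewrite mulr0 sumr_ge0 // => j _; rewrite mulr_ge0.
  rewrite mulr1.
  have [j kj] : exists j, hit k j.
    have ex : exists j, t k <= j%:R * delta.
      exists (Num.truncn (t k / delta)).+1; rewrite -ler_pdivrMr //.
      by rewrite ltW // truncnS_gt.
    case: (ex_minnP ex) => j kj min; exists j; rewrite /hit kj /=.
    case: j kj min => [|j] kj min.
      rewrite mul0r; apply: lt_le_trans (_ : delta + t k <= _); last by rewrite -lerBrDr.
      by rewrite ltr_pwDl // (le_trans t0) // (@time_mono R t tnd 0).
    have : j%:R * delta < t k by rewrite ltNge; apply/negP => /min; rewrite ltnn.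
    rewrite -(ltrD2l delta) -[X in X + _ * _]mul1r -mulrDl nat1r => /lt_le_trans; apply.
    by rewrite -lerBrDr.
  have jM : (j < M)%N.
    have [_ jk] := andP kj; rewrite -(ltr_nat R) -(ltr_pM2r d0).
    apply: lt_le_trans jk _; apply: le_trans tL.
    by apply: (time_mono tnd).
  rewrite (bigD1 (Ordinal jM)) //= kj mulr1 (le_trans (FG _ _ kj)) // lerDl.
  by rewrite sumr_ge0 // => i _; rewrite mulr_ge0.
rewrite exchange_big /=; apply: ler_sum => j _; rewrite -mulr_sumr.
rewrite ler_piMr //.
have [/existsP[k kj]|] := boolP [exists k : 'I_L, hit k j].
  rewrite (bigD1 k) //= kj big1 ?addr0 // => l lk.
  case: (boolP (hit l j)) => //= lj.
  have /eqP := interval_unique tnd kj lj; rewrite eq_sym => /eqP/val_inj lkE.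
  by rewrite lkE eqxx in lk.
rewrite negb_exists => /forallP H; rewrite big1 // => k _.
by rewrite (negbTE (H k)).
Qed.

Lemma threshold_measurable (R : realType) (delta : R) :
  measurable_fun [set: R] (fun h : R => (delta <= h)%R%:R : R).
Proof.
rewrite (_ : (fun h : R => _) = \1_`[delta, +oo[%classic); first exact: measurable_indic.
apply/funext => h; rewrite indicE; congr (_%:R).
by rewrite mem_setE in_itv /= andbT.
Qed.

(** Stability concerns all solutions; using it requires one, measurable at each time. *)
Lemma flow_path_solution (R : realType) (N n : nat) (A : 'I_N -> 'M[R]_n)
    (Z : switching R N n) (x0 : 'cV[R]_n) :
  (forall k, {ae Prob Z, forall w, 0 < holding k w}) ->
  solution A x0 (fun u (w : Omega Z) => flow_path A (fun l => mode l w)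
    (fun l => time l w) (fun l => reset l w) x0 u).
Proof.
move=> hpos; split; last first.
  have : {ae Prob Z, forall w, forall k, 0 < holding k w} by exact/ae_foralln.
  apply: filterS => w hw; apply: flow_path_trajectory; first exact: time0.
  by move=> k; rewrite -subr_gt0; exact: hw.
move=> u B mB.
pose S k : set (Omega Z) := [set w | time k w <= u < time k.+1 w].
pose M k (w : Omega Z) := expmx ((u - time k w) *: A (mode k w)) *m
  (flow A (fun l => mode l w) (fun l => time l w) (fun l => reset l w) k *m x0).
have mS k : measurable (S k).
  rewrite (_ : S k = time k @^-1` `]-oo, u]%classic `&` time k.+1 @^-1` `]u, +oo[%classic).
    by apply: measurableI; rewrite -[_ @^-1` _]setTI; exact: measurable_time.
  by apply/seteqP; split=> w /=; rewrite /S /= !in_itv /= andbT => /andP.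
have mM k : mx_measurable (M k).
  apply: mx_measurable_mul.
    apply: mx_measurable_expmx => [i|]; first exact: measurable_mode.
    by apply: measurable_funB => //; exact: measurable_time.
  apply: mx_measurable_mul; last exact: mx_measurable_cst.
  apply: mx_measurable_flow => [l i _|l _|l _].
  - exact: measurable_mode.
  - exact: measurable_time.
  - by move=> i j; apply: (measurableT_comp (borel_mat_coord i j)); exact: measurable_reset_fun.
rewrite (_ : _ @^-1` B = \bigcup_k (S k `&` M k @^-1` B) `|`
    (~` (\bigcup_k S k) `&` (fun=> 0) @^-1` B)).
  apply: measurableU.
    apply: bigcupT_measurable => k; apply: measurableI => //.
    exact: measurable_borel_mx.
  apply: measurableI; last by apply: measurable_borel_mx => //; exact: mx_measurable_cst.
  by apply: measurableC; exact: bigcupT_measurable.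
have pathE w k : S k w -> flow_path A (fun l => mode l w)
    (fun l => time l w) (fun l => reset l w) x0 u = M k w.
  by move=> Sk; rewrite (flow_pathE _ _ _ _ (fun l => time_nondecreasing l w) Sk).
apply/seteqP; split=> w /=.
  have [[k Skw]|no] := pselect (exists k, S k w).
    by rewrite (pathE _ _ Skw) => BM; left; exists k.
  move=> Bw; right; split; first by move=> [k _ Skw]; apply: no; exists k.
  move: Bw; rewrite /flow_path; case: pselect => //.
move=> [[k _ [Skw BM]]|[no B0]]; first by rewrite (pathE _ _ Skw).
rewrite /flow_path; case: pselect => // -[k kS].
by exfalso; apply: no; exists k.
Qed.

Section Necessity.
Context (R : realType) (N n m : nat) (A : 'I_N -> 'M[R]_n) (X : 'I_N -> switching R N n).
Variables (T K : R).
Hypotheses (smX : semi_markovian X) (posX : positive_system A X).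
Hypothesis hX : forall s k, {ae Prob (X s), forall w, 0 < holding k w <= T}.
Hypothesis JX : forall s k, {ae Prob (X s), forall w, `|reset k w| <= K}.

Local Notation TM := (transition_mx A m X).
Local Notation ones := (const_mx 1 : 'cV[R]_n).
Local Notation kappa := (lift_const n m R).

Let hpos s k : {ae Prob (X s), forall w, 0 < holding k w}.
Proof. by apply: filterS (hX s k) => w /andP[]. Qed.


Local Notation gauge k w := (`|cocycle A k w *m ones| ^+ m).

Lemma gauge_history_measurable s k : measurable_fun [set: history_space (X s) k]
  ((fun w : Omega (X s) => gauge k w) : history_space (X s) k -> R).
Proof.
apply: measurable_funX.
apply: (@mx_measurable_norm R _ (history_space (X s) k) n 1
  (fun w => @cocycle R N n A (X s) k w *m ones)).
apply: mx_measurable_mul; last exact: mx_measurable_cst.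
exact: cocycle_history_measurable.
Qed.

Lemma gauge_measurable s k : measurable_fun [set: Omega (X s)] (fun w => gauge k w).
Proof. by apply: (@history_measurable_fun _ _ _ (X s) k); exact: gauge_history_measurable. Qed.

Definition long_holding (delta : R) s k (w : Omega (X s)) : R := (delta <= holding k w)%R%:R.

Lemma long_holding_measurable delta s k :
  measurable_fun [set: Omega (X s)] (@long_holding delta s k).
Proof.
by apply: (measurableT_comp (threshold_measurable delta)); exact: measurable_holding.
Qed.

Lemma transition_mx_power_ge0 s k i a b : 0 <= submxblock (TM ^+ k) i s a b.
Proof.
rewrite -lee_fin -(moment_power smX posX hX JX); apply: integral_ge0 => w _.
by rewrite lee_fin (lift_cocycle_ge0 posX).
Qed.

(** Given the past, the current holding time is at least [delta] with probability at
    least 1/2, so restricting to this event costs at most a factor 2. *)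
Lemma transition_mx_power_le delta s k i a b :
  (forall j, (2^-1%:E <= Prob (X j) [set w | (delta <= holding 0 w)%R])%E) ->
  ((2^-1 * submxblock (TM ^+ k) i s a b)%:E <=
    (kappa ^+ 2)%:E * \int[Prob (X s)]_w (gauge k w * long_holding delta k w)%:E)%E.
Proof.
move=> Hdelta; have kk : 0 <= kappa ^+ 2 by rewrite exprn_ge0 // lift_const_ge0.
have mM : measurable (@mode_is _ _ _ (X s) k i) by exact: measurable_mode.
have mg : measurable_fun (mode_is k i) (fun w : Omega (X s) => (gauge k w)%:E).
  by apply/measurable_EFinP; apply: measurable_funTS; exact: gauge_measurable.
have g0 (w : Omega (X s)) : 0 <= gauge k w by exact: exprn_ge0.
have mgl : measurable_fun setT (fun w : Omega (X s) => (gauge k w * long_holding delta k w)%:E).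
  apply/measurable_EFinP; apply: measurable_funM; first exact: gauge_measurable.
  exact: long_holding_measurable.
apply: (@le_trans _ _ ((kappa ^+ 2)%:E *
    \int[Prob (X s)]_(w in mode_is k i) (gauge k w * long_holding delta k w)%:E)%E); last first.
  apply: lee_wpmul2l; rewrite ?lee_fin //.
  by apply: ge0_subset_integral => // w _; rewrite lee_fin mulr_ge0.
pose phi (y : R * borel_mat R n n) : R := (delta <= y.1)%R%:R.
have mphi : measurable_fun setT phi.
  apply: (measurableT_comp (threshold_measurable delta)); exact: measurable_fst.
have phi0 y : 0 <= phi y by [].
rewrite (semi_markov_total smX i (@gauge_history_measurable s k) g0 mphi phi0).
have -> : (\int[Prob (X i)]_w (phi (holding 0 w, reset 0 w))%:E =
    Prob (X i) [set w | (delta <= holding 0 w)%R])%E.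
  have mE := @measurable_holding_ge R N n (X i) 0 delta.
  rewrite -[[set w | _ <= holding 0 w]]setIT -integral_indic //; apply: eq_integral => w _.
  rewrite indicE /phi /=; congr ((nat_of_bool _)%:R%:E).
  by apply/idP/idP; rewrite inE.
rewrite EFinM muleC muleA; apply: lee_pmul => //.
- by rewrite lee_fin transition_mx_power_ge0.
- rewrite -(moment_power smX posX hX JX) -ge0_integralZl_EFin //.
  apply: ge0_le_integral => //.
  + by move=> w _; rewrite lee_fin (lift_cocycle_ge0 posX).
  + by apply/measurable_EFinP; apply: measurable_funTS; exact: cocycle_measurable.
  + exact: measurable_funeM.
  + by move=> w _; rewrite -EFinM lee_fin; exact: lift_cocycle_le.
Qed.

(** Stability controls the state at the deterministic times [j * delta]. If such a time
    lies in a holding interval, the state just after the preceding switch is the state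
    at this time up to the bounded factor [e^(- tau A)]. *)
Lemma stable_gauge_sum delta : 0 < delta -> exp_mean_stable A m X ->
  exists B, forall s L, (\sum_(k < L)
    \int[Prob (X s)]_w (gauge k w * long_holding delta k w)%:E <= B%:E)%E.
Proof.
move=> d0 [C [beta [C0 beta0 stab]]].
have [Ce Ce0 HCe] := expmx_bounded_modes A T.
pose D : R := (n%:R * Ce) ^+ m.
have D0 : 0 <= D by rewrite exprn_ge0 // mulr_ge0 // ltW.
pose q := expR (- beta * delta).
have q01 : 0 < q < 1 by rewrite expR_gt0 expR_lt1 mulNr oppr_lt0 mulr_gt0.
exists (D * C * (1 - q)^-1) => s L.
pose x u (w : Omega (X s)) := flow_path A (fun l => mode l w)
    (fun l => time l w) (fun l => reset l w) ones u.
have [mx xsol] : solution A ones x by exact: flow_path_solution.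
pose G j w : R := D * `|x (j%:R * delta) w| ^+ m.
have G0 j w : 0 <= G j w by rewrite mulr_ge0 // exprn_ge0.
have mG j : measurable_fun setT (fun w => (`|x (j%:R * delta) w| ^+ m)%:E).
  by apply/measurable_EFinP; exact: norm_solution_measurable.
have mgl k : measurable_fun setT (fun w : Omega (X s) => (gauge k w * long_holding delta k w)%:E).
  apply/measurable_EFinP; apply: measurable_funM; first exact: gauge_measurable.
  exact: long_holding_measurable.
have gl0 k (w : Omega (X s)) : 0 <= gauge k w * long_holding delta k w.
  by rewrite mulr_ge0 // exprn_ge0.
pose M := (Num.truncn (L%:R * T / delta)).+1.
have MT : L%:R * T <= M%:R * delta.
  by rewrite -ler_pdivrMr // ltW // truncnS_gt.
have pointwise (w : Omega (X s)) : regular T K w ->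
    \sum_(k < L) gauge k w * long_holding delta k w <= \sum_(j < M) G j w.
  move=> rw; apply: (@sampling_sum_le R (fun k => time k w) (fun k => gauge k w) (G^~ w) delta L M) => //.
  - by rewrite time0.
  - by move=> k; exact: time_nondecreasing.
  - exact: le_trans (regular_time_le rw L) MT.
  move=> k j kj; rewrite /G /D /x.
  rewrite (flow_pathE _ _ _ _ (fun l => time_nondecreasing l w) kj).
  rewrite (regular_flow A rw) -exprMn lerXn2r ?nnegrE ?mulr_ge0 ?(ltW Ce0) //.
  set tau := j%:R * delta - time k w.
  rewrite -[X in `|X| <= _]mul1mx -(expmxNK (A (mode k w)) tau) -mulmxA.
  apply: norm_mulmx_le; first exact: ltW.
  move=> a b; apply: HCe; rewrite normrN ger0_norm; last by rewrite subr_ge0; case/andP: kj.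
  have [/andP[_ hT] _ _] := rw k; apply: le_trans hT; rewrite lerB //.
  by apply: ltW; case/andP: kj.
rewrite -ge0_integral_sum //; last by move=> k w _; rewrite lee_fin.
apply: (@le_trans _ _ (\int[Prob (X s)]_w \sum_(j < M) (G j w)%:E)%E).
  apply: ae_ge0_le_integral => //.
  - by move=> w _; apply: sume_ge0 => k _; rewrite lee_fin.
  - exact: emeasurable_sum.
  - by move=> w _; apply: sume_ge0 => k _; rewrite lee_fin.
  - by apply: emeasurable_sum => j; under eq_fun do rewrite EFinM; exact: measurable_funeM.
  - apply: filterS (ae_regular posX hX JX s) => w rw _.
    by rewrite !sumEFin lee_fin; exact: pointwise.
rewrite ge0_integral_sum //; last first.
- by move=> j w _; rewrite lee_fin.
- by move=> j; under eq_fun do rewrite EFinM; exact: measurable_funeM.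
apply: (@le_trans _ _ (\sum_(j < M) (D * C * q ^+ j)%:E)%E).
  apply: lee_sum => j _; under eq_integral do rewrite EFinM.
  rewrite ge0_integralZl_EFin //.
  rewrite -mulrA [leRHS]EFinM; apply: lee_wpmul2l; first by rewrite lee_fin.
  have := stab s ones x (conj mx xsol) (j%:R * delta).
  rewrite mulr_ge0 ?(ltW d0) // => /(_ isT); rewrite unlock => /le_trans; apply.
  rewrite lee_fin -mulrA ler_wpM2l ?(ltW C0) //.
  rewrite mulrCA expRM_natl ler_piMr ?exprn_ge0 ?expR_ge0 //.
  by rewrite exprn_ile1 // norm_ones_le1.
rewrite sumEFin lee_fin -mulr_sumr ler_wpM2l //; last exact: geometric_sum_le.
by rewrite mulr_ge0 // ltW.
Qed.

(** The entries of the powers of the transition matrix are nonnegative and have bounded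
    partial sums, hence tend to 0. *)
Lemma stable_spectral_radius_lt1 : exp_mean_stable A m X -> spectral_radius TM < 1.
Proof.
move=> stab; have [delta d0 Hdelta] := holding_lower_bound hpos.
have [B HB] := stable_gauge_sum d0 stab.
have entries s i a b : submxblock (TM ^+ k) i s a b @[k --> \oo] --> 0.
  apply: cvg_series_cvg_0; apply: nondecreasing_is_cvgn.
    apply/nondecreasing_seqP => k; rewrite !seriesEnat /= big_nat_recr //= lerDl.
    exact: transition_mx_power_ge0.
  exists (2 * (kappa ^+ 2 * B)) => _ [L _ <-]; rewrite seriesEnat /= big_mkord.
  rewrite -ler_pdivrMl // -lee_fin mulr_sumr -sumEFin.
  apply: (@le_trans _ _ (\sum_(k < L) (kappa ^+ 2)%:E *
      \int[Prob (X s)]_w (gauge k w * long_holding delta k w)%:E)%E).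
    by apply: lee_sum => k _; exact: transition_mx_power_le.
  rewrite -ge0_sume_distrr; last first.
    by move=> k _; apply: integral_ge0 => w _; rewrite lee_fin mulr_ge0 // exprn_ge0.
  rewrite [leRHS]EFinM lee_wpmul2l ?HB //.
  by rewrite lee_fin exprn_ge0 // lift_const_ge0.
apply: spectral_radius_lt1_of_cvg => c d.
under eq_cvg do rewrite -[TM ^+ _]submxblockK mxE.
exact: entries.
Qed.

End Necessity.

Theorem theorem2p5 (R : realType) (N n m : nat)
    (A : 'I_N -> 'M[R]_n) (X : 'I_N -> switching R N n) (T K : R) :
  (0 < m)%N -> 0 < T -> 0 < K ->
  semi_markovian X -> positive_system A X ->
  (forall s k, {ae Prob (X s), forall w, 0 < holding k w <= T}) ->
  (forall s k, {ae Prob (X s), forall w, `|reset k w| <= K}) ->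
  exp_mean_stable A m X <-> spectral_radius (transition_mx A m X) < 1.
Proof.
move=> m0 T0 K0 smX posX hX JX; split.
  exact: (stable_spectral_radius_lt1 smX posX hX JX).
exact: (spectral_radius_lt1_stable m0 T0 smX posX hX JX).
Qed.
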